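(* Let $\varphi:(M^{2n+1},g)\to(N^{2n},J,h)$ be a pseudo horizontally weakly conformal (PHWC) submersion from an oriented Riemannian manifold onto a Hermitian manifold, and let $(\phi,\xi,\eta,g)$ be the almost contact metric structure naturally induced by $\varphi$ on $M$. Then this almost contact structure is normal if and only if one of the following equivalent conditions holds: (i) the fibers of $\varphi$ are minimal and $d\eta(\phi X,\phi Y)=d\eta(X,Y)$ for all vector fields $X,Y$ on $M$; (ii) $\nabla_\xi\phi=0$, i.e. $\phi$ is parallel along the fibers (in particular, the fibers are then minimal).
   Context: A map $\varphi:(M,g)\to(N,J,h)$ is PHWC if $[d\varphi\circ d\varphi^{*},J]=0$, where $d\varphi_x^*:T_{\varphi(x)}N\to T_xM$ is the adjoint, $g(X,d\varphi_x^*(E))=h(d\varphi_x(X),E)$. A Hermitian manifold has integrable $J$. Induced almost contact metric structure: let $\mathcal{V}=\ker d\varphi$ (a line bundle) and $\mathcal{H}=\mathcal{V}^\perp$. $\mathcal H$ carries the almost complex structure $J_{\mathcal H}=(d\varphi|_{\mathcal H})^{-1}\circ J\circ d\varphi|_{\mathcal H}$, which by PHWC is compatible with $g$; thus $\mathcal H$ is oriented and, $M$ being oriented, $\mathcal V$ is orientable, hence trivial. Choose a global unit section $\xi$ of $\mathcal V$ and set $\phi|_{\mathcal H}=J_{\mathcal H}$, $\phi\xi=0$, $\eta(X)=g(X,\xi)$. Then $\phi^2=-I+\eta\otimes\xi$, $\eta(\xi)=1$, $g(\phi X,\phi Y)=g(X,Y)-\eta(X)\eta(Y)$. The almost contact structure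 is normal if $N^{(1)}(X,Y)=[\phi,\phi](X,Y)+2d\eta(X,Y)\xi=0$ for all $X,Y$, where $[\phi,\phi](X,Y)=\phi^2[X,Y]+[\phi X,\phi Y]-\phi[\phi X,Y]-\phi[X,\phi Y]$ and $2d\eta(X,Y)=X\eta(Y)-Y\eta(X)-\eta([X,Y])$. $\nabla$ is the Levi-Civita connection of $g$. *)

(* Defs.v *)
From HB Require Import structures.
From mathcomp Require Import all_boot all_order all_algebra.
From mathcomp Require Import all_classical all_reals all_analysis.

Set Implicit Arguments.
Unset Strict Implicit.
Unset Printing Implicit Defensive.

Import Order.TTheory GRing.Theory Num.Theory.
Import numFieldNormedType.Exports.

Local Open Scope classical_set_scope.
Local Open Scope ring_scope.

Section Smooth.
Context {R : realType} {V W : normedModType R}.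

(* Meant for [U] open.  In finite dimension, [f] is C^(k+1) iff it is
   differentiable and all its directional derivatives are C^k. *)
Fixpoint Ck_on (k : nat) (U : set V) (f : V -> W) : Prop :=
  match k with
  | 0 => forall x, U x -> {for x, continuous f}
  | k'.+1 => (forall x, U x -> differentiable f x) /\
             (forall v : V, Ck_on k' U (fun x => 'D_v f x))
  end.

Definition smooth_on (U : set V) (f : V -> W) : Prop :=
  forall k, Ck_on k U f.

End Smooth.

(* Only the values of [cfun] on [cdom], and those of [cinv] on the image of
   [cdom], are meaningful. *)
Record chart (R : realType) (m : nat) (M : topologicalType) := Chart {
  cdom : set M;
  cfun :> M -> 'rV[R]_m;
  cinv : 'rV[R]_m -> M;
  cdom_open : open cdom;
  cimg_open : open (cfun @` cdom);
  cfunK : forall x, cdom x -> cinv (cfun x) = x;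
  cfun_cont : forall x, cdom x -> {for x, continuous cfun};
  cinv_cont : forall p, (cfun @` cdom) p -> {for p, continuous cinv}
}.

Definition smooth_transition (R : realType) (m : nat) (M : topologicalType)
    (c d : chart R m M) : Prop :=
  smooth_on (c @` (cdom c `&` cdom d)) (d \o cinv c).

Record manifold (R : realType) (m : nat) := Manifold {
  mpoint :> topologicalType;
  atlas : set (chart R m mpoint);
  manifold_hausdorff : hausdorff_space mpoint;
  manifold_second_countable : @second_countable mpoint;
  atlas_cover : forall x : mpoint, exists2 c, atlas c & cdom c x;
  atlas_smooth : forall c d, atlas c -> atlas d -> smooth_transition c d
}.

Section OneManifold.
Context {R : realType} {m : nat} (M : manifold R m).
Implicit Types (c d : chart R m M) (x : M).

Definition chart_at x : chart R m M := s2val (cid2 (atlas_cover x)).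

Definition compatible_chart c : Prop :=
  forall d, atlas d -> smooth_transition c d /\ smooth_transition d c.

Definition orientation (O : set (chart R m M)) : Prop :=
  [/\ O `<=` compatible_chart,
      forall x, exists2 c, O c & cdom c x
    & forall c d x, O c -> O d -> cdom c x -> cdom d x ->
        0 < \det ('J (d \o cinv c) (c x))].

(* A tangent vector at x is represented by its components in the chart
   [chart_at x], so that T_x M is the vector space 'rV[R]_m. *)
Definition vfield := M -> 'rV[R]_m.
Definition endo := forall x : M, {linear 'rV[R]_m -> 'rV[R]_m}.

(* Components in the chart c of the tangent vector v at x, and conversely the
   tangent vector at x having components e in the chart c. *)
Definition tcoord c x (v : 'rV[R]_m) : 'rV[R]_m :=
  'd (c \o cinv (chart_at x)) (chart_at x x) v.
Definition tvec c x (e : 'rV[R]_m) : 'rV[R]_m :=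
  'd (chart_at x \o cinv c) (c x) e.

Definition smooth_fun (f : M -> R) : Prop :=
  forall c, atlas c -> smooth_on (c @` cdom c) (f \o cinv c).

Definition vf_rep c (X : vfield) : 'rV[R]_m -> 'rV[R]_m :=
  fun p => tcoord c (cinv c p) (X (cinv c p)).

Definition smooth_vf (X : vfield) : Prop :=
  forall c, atlas c -> smooth_on (c @` cdom c) (vf_rep c X).

Definition smooth_endo (A : endo) : Prop :=
  forall c (e : 'rV[R]_m), atlas c ->
    smooth_on (c @` cdom c)
      (vf_rep c (fun x => A x (tvec c x e))).

Definition endo_app (A : endo) (X : vfield) : vfield := fun x => A x (X x).

(* The derivative X f of a function along a vector field. *)
Definition vderiv (X : vfield) (f : M -> R) : M -> R :=
  fun x => 'D_(X x) (f \o cinv (chart_at x)) (chart_at x x).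

(* [X, Y]^j = X^i d_i Y^j - Y^i d_i X^j, in the chart [chart_at x]. *)
Definition bracket (X Y : vfield) : vfield := fun x =>
  'D_(X x) (vf_rep (chart_at x) Y) (chart_at x x)
  - 'D_(Y x) (vf_rep (chart_at x) X) (chart_at x x).

Record riem_metric := Metric {
  mform :> M -> 'rV[R]_m -> 'rV[R]_m -> R;
  metric_linear : forall x w (a : R) u v,
    mform x (a *: u + v) w = a * mform x u w + mform x v w;
  metric_sym : forall x u v, mform x u v = mform x v u;
  metric_pos : forall x v, v != 0 -> 0 < mform x v v;
  metric_smooth : forall c (e e' : 'rV[R]_m), atlas c ->
    smooth_on (c @` cdom c)
      ((fun x => mform x (tvec c x e) (tvec c x e')) \o cinv c)
}.

Record levi_civita (g : riem_metric) (nabla : vfield -> vfield -> vfield) : Prop :=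
  LeviCivita {
  lc_smooth : forall X Y, smooth_vf X -> smooth_vf Y -> smooth_vf (nabla X Y);
  lc_linear : forall (f : M -> R) X X' Y, smooth_fun f ->
    smooth_vf X -> smooth_vf X' -> smooth_vf Y -> forall x,
    nabla (fun y => f y *: X y + X' y) Y x = f x *: nabla X Y x + nabla X' Y x;
  lc_add : forall X Y Y', smooth_vf X -> smooth_vf Y -> smooth_vf Y' ->
    forall x, nabla X (fun y => Y y + Y' y) x = nabla X Y x + nabla X Y' x;
  lc_leibniz : forall (f : M -> R) X Y, smooth_fun f ->
    smooth_vf X -> smooth_vf Y -> forall x,
    nabla X (fun y => f y *: Y y) x = vderiv X f x *: Y x + f x *: nabla X Y x;
  lc_torsion_free : forall X Y, smooth_vf X -> smooth_vf Y ->
    forall x, nabla X Y x - nabla Y X x = bracket X Y x;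
  lc_metric : forall X Y Z, smooth_vf X -> smooth_vf Y -> smooth_vf Z ->
    forall x, vderiv X (fun y => g y (Y y) (Z y)) x
              = g x (nabla X Y x) (Z x) + g x (Y x) (nabla X Z x)
}.

(* (nabla_X A) Y *)
Definition nabla_endo (nabla : vfield -> vfield -> vfield) (X : vfield)
    (A : endo) (Y : vfield) : vfield :=
  fun x => nabla X (endo_app A Y) x - A x (nabla X Y x).

(* The exterior derivative of a 1-form, with the convention
   2 d eta (X, Y) = X eta(Y) - Y eta(X) - eta([X, Y]). *)
Definition dform (eta : M -> 'rV[R]_m -> R) (X Y : vfield) : M -> R := fun x =>
  2^-1 * (vderiv X (fun y => eta y (Y y)) x - vderiv Y (fun y => eta y (X y)) x
          - eta x (bracket X Y x)).

(* [phi, phi](X, Y) *)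
Definition nijenhuis (phi : endo) (X Y : vfield) : vfield := fun x =>
  phi x (phi x (bracket X Y x)) + bracket (endo_app phi X) (endo_app phi Y) x
  - phi x (bracket (endo_app phi X) Y x) - phi x (bracket X (endo_app phi Y) x).

Definition normal_structure (phi : endo) (xi : vfield) (eta : M -> 'rV[R]_m -> R) : Prop :=
  forall X Y, smooth_vf X -> smooth_vf Y -> forall x,
    nijenhuis phi X Y x + (2 * dform eta X Y x) *: xi x = 0.

End OneManifold.

Section Hermitian.
Context {R : realType} {n : nat} {N : manifold R (n + n)}.

(* The complex structure of C^n = R^n + i R^n : d/dx_k |-> d/dy_k |-> - d/dx_k,
   a row vector being split as (x_1, ..., x_n, y_1, ..., y_n). *)
Definition std_complex (v : 'rV[R]_(n + n)) : 'rV[R]_(n + n) :=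
  row_mx (- rsubmx v) (lsubmx v).

(* J is induced by a complex manifold structure: around every point there are
   smooth coordinates in which J is the standard complex structure. *)
Definition integrable_acs (J : endo N) : Prop :=
  forall y : N, exists c : chart R (n + n) N,
    [/\ compatible_chart c, cdom c y
      & forall z v, cdom c z -> tcoord c z (J z v) = std_complex (tcoord c z v)].

Record hermitian_structure (J : endo N) (h : riem_metric N) : Prop := Hermitian {
  herm_square : forall y v, J y (J y v) = - v;
  herm_smooth : smooth_endo J;
  herm_compat : forall y u v, h y (J y u) (J y v) = h y u v;
  herm_integrable : integrable_acs J
}.

End Hermitian.

Section Maps.
Context {R : realType} {m p : nat} {M : manifold R m} {N : manifold R p}.
Variable f : M -> N.

Definition smooth_map : Prop := continuous f /\
  forall (c : chart R m M) (d : chart R p N), atlas c -> atlas d ->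
    smooth_on (c @` (cdom c `&` f @^-1` cdom d)) (d \o f \o cinv c).

Definition dmap (x : M) (v : 'rV[R]_m) : 'rV[R]_p :=
  'd (chart_at (f x) \o f \o cinv (chart_at x)) (chart_at x x) v.

Definition submersion : Prop :=
  smooth_map /\ forall x w, exists v, dmap x v = w.

Definition adjoint_at (g : riem_metric M) (h : riem_metric N) (x : M)
    (A : 'rV[R]_p -> 'rV[R]_m) : Prop :=
  forall X E, g x X (A E) = h (f x) (dmap x X) E.

(* The adjoint exists and is unique, and is here bound by [exists]. *)
Definition PHWC (g : riem_metric M) (J : endo N) (h : riem_metric N) : Prop :=
  forall x, exists2 A, adjoint_at g h x A &
    forall E, dmap x (A (J (f x) E)) = J (f x) (dmap x (A E)).

Definition vertical (x : M) (v : 'rV[R]_m) : Prop := dmap x v = 0.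

Definition horizontal (g : riem_metric M) (x : M) (v : 'rV[R]_m) : Prop :=
  forall w, vertical x w -> g x v w = 0.

(* The orthogonal projection of v onto H: the unique horizontal vector that
   differs from v by a vertical one. *)
Definition horizontal_part (g : riem_metric M) (x : M) (v : 'rV[R]_m) : 'rV[R]_m :=
  get [set u | horizontal g x u /\ vertical x (v - u)].

Definition second_fundamental_form (g : riem_metric M)
    (nabla : vfield M -> vfield M -> vfield M) (U W : vfield M) : vfield M :=
  fun x => horizontal_part g x (nabla U W x).

Definition vertical_basis (g : riem_metric M) (x : M) (k : nat)
    (E : 'I_k -> 'rV[R]_m) : Prop :=
  [/\ forall i, vertical x (E i),
      forall i j, g x (E i) (E j) = (i == j)%:R
    & forall v, vertical x v -> v = \sum_(i < k) g x v (E i) *: E i].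

(* The mean curvature of the fibers vanishes.  On vertical fields the second
   fundamental form is tensorial, so its trace at x can be computed from any
   vertical fields that are orthonormal at x, and such fields always exist. *)
Definition minimal_fibers (g : riem_metric M)
    (nabla : vfield M -> vfield M -> vfield M) : Prop :=
  forall (x : M) (k : nat) (E : 'I_k -> vfield M),
    (forall i, smooth_vf (E i)) ->
    (forall i y, vertical y (E i y)) ->
    vertical_basis g x (fun i => E i x) ->
    k%:R^-1 *: \sum_(i < k) second_fundamental_form g nabla (E i) (E i) x = 0.

(* phi is J_H = (df|_H)^-1 o J o df|_H on H and vanishes on xi, where xi is a
   global unit section of the line bundle ker df; this xi is unique up to sign
   on each connected component. *)
Record induced_structure (g : riem_metric M) (J : endo N)
    (phi : endo M) (xi : vfield M) (eta : M -> 'rV[R]_m -> R) : Prop :=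
  InducedStructure {
  ind_xi_smooth : smooth_vf xi;
  ind_xi_vertical : forall x, vertical x (xi x);
  ind_xi_unit : forall x, g x (xi x) (xi x) = 1;
  ind_phi_xi : forall x, phi x (xi x) = 0;
  ind_phi_horizontal : forall x v, horizontal g x v ->
    horizontal g x (phi x v) /\ dmap x (phi x v) = J (f x) (dmap x v);
  ind_eta : forall x v, eta x v = g x v (xi x)
}.

End Maps.

(* Main.v *)
(* In a holomorphic chart of N, the map phi is related by the differential of f
   to a constant complex structure, so the Nijenhuis tensor of phi is vertical,
   and its component along xi is -2 d eta (phi X, phi Y).  Hence the structure
   is normal iff d eta (phi X, phi Y) = d eta (X, Y); taking X = xi gives
   nabla_xi xi = 0, that is, minimal fibers.

   Put B (X, Y) = g (nabla_X xi, Y), so that 2 d eta (X, Y) = B (X, Y) - B (Y, X).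
   The Lie derivative of phi along xi is vertical for the same reason as above,
   whence
     g ((nabla_xi phi) Y, Z) = B (phi Y, Z) + B (Y, phi Z)
                               - eta (Z) B (xi, phi Y).
   The left-hand side is antisymmetric in Y and Z because phi is skew, which is
   where PHWC enters, so that only d eta is left when nabla_xi xi = 0.

   All identities are evaluated on global vector fields such as phi X, nabla_X Y
   and eta (Y) xi, so no localization of the connection is needed. *)
Require Import Defs.
From mathcomp Require Import all_boot all_order all_algebra.
From mathcomp Require Import all_classical all_reals all_analysis.
From mathcomp Require Import ring lra.

Set Implicit Arguments.
Unset Strict Implicit.
Unset Printing Implicit Defensive.

Import Order.TTheory GRing.Theory Num.Theory.
Import numFieldNormedType.Exports.

Local Open Scope classical_set_scope.
Local Open Scope ring_scope.

(** * Germs of smooth maps *)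

Section Germs.
Context {R : realType} {V W : normedModType R}.
Implicit Types (f g : V -> W) (x y v : V).

(** The first-order expansion of [f] at [x] is also one of [g], since the two agree near [x];
    uniqueness of the linear part then identifies ['d g x]. *)
Lemma near_eq_is_diff f g x :
  (\forall y \near x, f y = g y) -> differentiable f x -> is_diff x g ('d f x).
Proof.
move=> fg df.
have fgx : f x = g x by exact: nbhs_singleton fg.
suff e : g \o shift x = cst (g x) + 'd f x +o_ 0 id.
  have dfE : 'd g x = 'd f x :> (V -> W).
    by apply: diff_unique => //; exact: diff_continuous.
  apply: DiffDef => //; apply/diff_locallyP; rewrite dfE; split => //.
  exact: diff_continuous.
have /eqaddoP dfo := diff_locally df.
apply/eqaddoP => e /dfo; apply: filter_app.
have fg0 : \forall h \near 0, f (h + x) = g (h + x).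
  by have := fg; rewrite (near_shift 0) subr0 => fg'; apply: filterS fg'.
by apply: filterS fg0 => h /= E; rewrite !fctE /= E fgx.
Qed.

Lemma near_eq_differentiable f g x :
  (\forall y \near x, f y = g y) -> differentiable f x -> differentiable g x.
Proof. by move=> /near_eq_is_diff h /h []. Qed.

Lemma near_eq_continuous f g x :
  (\forall y \near x, f y = g y) -> {for x, continuous f} -> {for x, continuous g}.
Proof.
move=> fg cf; have fgx : f x = g x by exact: nbhs_singleton fg.
rewrite /prop_for /continuous_at -fgx; apply: cvg_trans cf; apply: near_eq_cvg.
by apply: filterS fg.
Qed.

Lemma near_eq_deriv f g v x :
  (\forall y \near x, f y = g y) -> 'D_v f x = 'D_v g x.
Proof.
by move=> fg; have [->|v0] := eqVneq v 0; [rewrite !derive0 | exact: near_eq_derive].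
Qed.

(* A germ version of [Ck_on], insensitive to the choice of the open set. *)
Fixpoint Ck_at (k : nat) f x : Prop :=
  match k with
  | 0 => \forall y \near x, {for y, continuous f}
  | k'.+1 => (\forall y \near x, differentiable f y) /\
             (forall v, Ck_at k' ('D_v f) x)
  end.

Definition smooth_at f x := forall k, Ck_at k f x.

End Germs.

(** * Locality and additivity of [C^k] germs *)

Section CkAt.
Context {R : realType} {V W : normedModType R}.
Implicit Types (f g : V -> W) (x y v : V).

Lemma Ck_on_at k (U : set V) f x : open U -> Ck_on k U f -> U x -> Ck_at k f x.
Proof.
move=> oU; elim: k f => [|k IH] f /= cf Ux.
  by apply: filterS (open_nbhs_nbhs (conj oU Ux)) => y; exact: cf.
case: cf => df cf; split=> [|v]; last exact: IH (cf v) Ux.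
by apply: filterS (open_nbhs_nbhs (conj oU Ux)) => y; exact: df.
Qed.

Lemma Ck_at_on k (U : set V) f : (forall x, U x -> Ck_at k f x) -> Ck_on k U f.
Proof.
elim: k f => [|k IH] f /= cf.
  by move=> x /cf /nbhs_singleton.
split=> [x /cf[/nbhs_singleton//]|v].
by apply: IH => x /cf[_]; apply.
Qed.

(** Bridge between the definitions on chart images and the germ calculus, where all later smoothness
    proofs take place. *)
Lemma smooth_onP (U : set V) f : open U ->
  smooth_on U f <-> (forall x, U x -> smooth_at f x).
Proof.
move=> oU; split=> [sf x Ux k|sf k]; first exact: Ck_on_at (sf k) Ux.
by apply: Ck_at_on => x Ux; exact: sf.
Qed.

Lemma near_eq_Ck_at k f g x :
  (\forall y \near x, f y = g y) -> Ck_at k f x -> Ck_at k g x.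
Proof.
elim: k f g => [|k IH] f g fg /=.
  move=> cf; apply: filterS2 cf (near_join fg) => y cf fgy.
  exact: near_eq_continuous fgy cf.
case=> df cf; split.
  apply: filterS2 df (near_join fg) => y df fgy.
  exact: near_eq_differentiable fgy df.
move=> v; apply: IH (cf v).
by apply: filterS (near_join fg) => y fgy; exact: near_eq_deriv.
Qed.

Lemma near_eq_smooth_at f g x :
  (\forall y \near x, f y = g y) -> smooth_at f x -> smooth_at g x.
Proof. by move=> fg sf k; exact: near_eq_Ck_at fg (sf k). Qed.

Lemma Ck_atW k f x : Ck_at k.+1 f x -> Ck_at k f x.
Proof.
elim: k f => [|k IH] f [df cf] /=.
  by apply: filterS df => y; exact: differentiable_continuous.
by split=> // v; apply: IH; exact: cf.
Qed.

Lemma Ck_at_continuous k f x : Ck_at k f x -> {for x, continuous f}.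
Proof.
elim: k => [/nbhs_singleton //|k IH] /Ck_atW; exact: IH.
Qed.

Lemma smooth_at_near_diff f x : smooth_at f x -> \forall y \near x, differentiable f y.
Proof. by move=> /(_ 1%N)[]. Qed.

Lemma smooth_at_diff f x : smooth_at f x -> differentiable f x.
Proof. by move=> /smooth_at_near_diff /nbhs_singleton. Qed.

Lemma smooth_at_continuous f x : smooth_at f x -> {for x, continuous f}.
Proof. by move=> /(_ 0%N) /Ck_at_continuous. Qed.

Lemma smooth_at_deriv f x v : smooth_at f x -> smooth_at ('D_v f) x.
Proof. by move=> sf k; have [_] := sf k.+1; apply. Qed.

Lemma Ck_at_cst k (w : W) x : Ck_at k (fun=> w) x.
Proof.
elim: k w => [|k IH] w /=; first by near=> y; exact: cst_continuous.
split=> [|v]; first by near=> y; exact: differentiable_cst.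
rewrite (_ : 'D_v _ = fun=> 0); first exact: IH.
by apply/funext => y; exact: derive_cst.
Unshelve. all: by end_near. Qed.

Lemma Ck_atD k f g x : Ck_at k f x -> Ck_at k g x -> Ck_at k (f \+ g) x.
Proof.
elim: k f g => [|k IH] f g /=.
  by apply: filterS2 => y; exact: continuousD.
move=> [df cf] [dg cg]; split.
  by apply: filterS2 df dg => y; exact: differentiableD.
move=> v; apply: near_eq_Ck_at (IH _ _ (cf v) (cg v)).
apply: filterS2 df dg => y df dg /=.
by symmetry; apply: deriveD; exact: diff_derivable.
Qed.

Lemma Ck_at_sum k (I : Type) (s : seq I) (F : I -> V -> W) x :
  (forall i, Ck_at k (F i) x) -> Ck_at k (fun y => \sum_(i <- s) F i y) x.
Proof.
move=> cF; elim: s => [|i s IH].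
  rewrite (_ : (fun _ => _) = fun=> 0); first exact: Ck_at_cst.
  by apply/funext => y; rewrite big_nil.
rewrite (_ : (fun _ => _) = F i \+ (fun y => \sum_(i <- s) F i y)).
  exact: Ck_atD.
by apply/funext => y; rewrite big_cons.
Qed.

End CkAt.

(** * Products and inverses of scalar germs *)

Section CkAtScalar.
Context {R : realType} {V : normedModType R}.
Implicit Types (f g : V -> R) (x y v : V).

(** The derivative of a product involves [f] and [g] themselves besides their derivatives, so the
    induction lowers their order with [Ck_atW]. *)
Lemma Ck_atM k f g x : Ck_at k f x -> Ck_at k g x -> Ck_at k (f \* g) x.
Proof.
elim: k f g => [|k IH] f g.
  by rewrite /=; apply: filterS2 => y; exact: continuousM.
move=> cf' cg'; have [df cf] := cf'; have [dg cg] := cg'; split.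
  by apply: filterS2 df dg => y; exact: differentiableM.
move=> v; apply: near_eq_Ck_at
  (Ck_atD (IH _ _ (Ck_atW cf') (cg v)) (IH _ _ (Ck_atW cg') (cf v))).
apply: filterS2 df dg => y df dg /=.
by symmetry; apply: deriveM; exact: diff_derivable.
Qed.

Lemma Ck_at_prod k (I : Type) (s : seq I) (F : I -> V -> R) x :
  (forall i, Ck_at k (F i) x) -> Ck_at k (fun y => \prod_(i <- s) F i y) x.
Proof.
move=> cF; elim: s => [|i s IH].
  rewrite (_ : (fun _ => _) = fun=> 1); first exact: Ck_at_cst.
  by apply/funext => y; rewrite big_nil.
rewrite (_ : (fun _ => _) = F i \* (fun y => \prod_(i <- s) F i y)).
  exact: Ck_atM.
by apply/funext => y; rewrite big_cons.
Qed.

Lemma Ck_at_inv k f x : f x != 0 -> Ck_at k f x -> Ck_at k (fun y => (f y)^-1) x.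
Proof.
move=> fx0; elim: k => [|k IH] cf'.
  have f0 : \forall y \near x, f y != 0.
    exact: (cvgr_neq0 _ (Ck_at_continuous cf') fx0).
  by apply: filterS2 f0 cf' => y f0 cf; exact: continuousV.
have f0 : \forall y \near x, f y != 0.
    exact: (cvgr_neq0 _ (Ck_at_continuous cf') fx0).
have [df cf] := cf'; split.
  by apply: filterS2 f0 df => y f0 df; exact: differentiableV.
move=> v; have ci := IH (Ck_atW cf').
(* The derivative of the inverse, written as a product so that the induction hypothesis on the
   inverse itself can be used. *)
apply: (@near_eq_Ck_at _ _ _ k
  (fun y => -1 * ((f y)^-1 * (f y)^-1) * 'D_v f y)); last first.
  apply: Ck_atM (cf v); apply: Ck_atM (Ck_atM ci ci); exact: Ck_at_cst.
apply: filterS2 f0 df => y f0 df /=.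
have -> : 'D_v (fun z => (f z)^-1) y = - (f y) ^- 2 *: 'D_v f y.
  by rewrite deriveV//; exact: diff_derivable.
by rewrite mulN1r -invfM -expr2.
Qed.

End CkAtScalar.

(** * Row-valued germs, entry by entry *)

Section CkAtRow.
Context {R : realType} {V : normedModType R}.
Implicit Types (x y v : V).

Lemma Ck_atZl (W : normedModType R) k (a : V -> R) (w : W) x :
  Ck_at k a x -> Ck_at k (fun y => a y *: w) x.
Proof.
elim: k a => [|k IH] a /=.
  by apply: filterS => y; exact: continuousZr_tmp.
case=> da ca; split; first by apply: filterS da => y; exact: differentiableZl.
move=> v; apply: near_eq_Ck_at (IH _ (ca v)).
apply: filterS da => y da.
rewrite (deriveE _ da) [RHS]deriveE; last exact: differentiableZl.
by rewrite diffZl.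
Qed.

Lemma differentiable_entry m n (f : V -> 'M[R]_(m, n)) x i j :
  differentiable f x -> differentiable (fun y => f y i j) x.
Proof.
move=> df; apply: (@differentiable_comp _ _ _ _ f (fun M : 'M[R]_(m, n) => M i j)) => //.
exact: differentiable_coord.
Qed.

Lemma derive_entry m n (f : V -> 'M[R]_(m, n)) x v i j :
  differentiable f x -> 'D_v (fun y => f y i j) x = 'D_v f x i j.
Proof.
by move=> df; rewrite derive_mx ?mxE//; exact: diff_derivable.
Qed.

Lemma Ck_at_entry k m n (f : V -> 'M[R]_(m, n)) x i j :
  Ck_at k f x -> Ck_at k (fun y => f y i j) x.
Proof.
elim: k f => [|k IH] f /=.
  by apply: filterS => y cf; exact: (continuous_comp cf (@coord_continuous _ _ _ _ _ _)).
case=> df cf; split; first by apply: filterS df => y; exact: differentiable_entry.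
move=> v; apply: near_eq_Ck_at (IH _ (cf v)).
by apply: filterS df => y df; rewrite derive_entry.
Qed.

(** Reduction to scalar functions: a row-valued map is the sum of its entries times the constant
    vectors [delta_mx 0 j]. *)
Lemma Ck_at_rowP k n (f : V -> 'rV[R]_n) x :
  Ck_at k f x <-> forall j, Ck_at k (fun y => f y 0 j) x.
Proof.
split=> [cf j|cf]; first exact: Ck_at_entry.
rewrite (_ : f = fun y => \sum_j f y 0 j *: delta_mx 0 j); last first.
  by apply/funext => y; rewrite [LHS]row_sum_delta.
by apply: Ck_at_sum => j; exact: Ck_atZl.
Qed.

Lemma diff_row_sum (W : normedModType R) n (g : 'rV[R]_n -> W) p w :
  differentiable g p ->
  'd g p w = \sum_i w 0 i *: 'D_(delta_mx 0 i) g p.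
Proof.
move=> dg; rewrite [X in 'd g p X]row_sum_delta linear_sum.
by apply: eq_bigr => i _; rewrite linearZ/= deriveE.
Qed.

End CkAtRow.

(** * Composition of germs *)

Section CkAtComp.
Context {R : realType} {V : normedModType R}.
Implicit Types (x y v : V).

(** By the chain rule the derivative is a sum of products of entries of ['D_v f] with partial
    derivatives of [g] taken along [f], and the induction hypothesis applies to those partial
    derivatives. *)
Lemma Ck_at_comp n k (g : 'rV[R]_n -> R) (f : V -> 'rV[R]_n) x :
  Ck_at k g (f x) -> Ck_at k f x -> Ck_at k (g \o f) x.
Proof.
elim: k g => [|k IH] g cg' cf'.
  have cg : \forall y \near x, {for f y, continuous g}.
    exact: (Ck_at_continuous cf') cg'.
  by apply: filterS2 cf' cg => y; exact: continuous_comp.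
have [dg' cg] := cg'; have [df cf] := cf'.
have dg : \forall y \near x, differentiable g (f y).
  exact: (Ck_at_continuous cf') dg'.
split; first by apply: filterS2 df dg => y; exact: differentiable_comp.
move=> v; apply: (@near_eq_Ck_at _ _ _ _ (fun y =>
    \sum_i ('D_v f y) 0 i * ('D_(delta_mx 0 i) g \o f) y)).
  apply: filterS2 df dg => y df dg.
  rewrite [RHS]deriveE; last exact: differentiable_comp.
  rewrite diff_comp//= diff_row_sum//.
  by apply: eq_bigr => i _; rewrite deriveE.
apply: Ck_at_sum => i; apply: Ck_atM; first exact/Ck_at_entry/cf.
by apply: IH; [exact: cg | exact: Ck_atW].
Qed.

Lemma Ck_at_comp_row k n p (g : 'rV[R]_n -> 'rV[R]_p) (f : V -> 'rV[R]_n) x :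
  Ck_at k g (f x) -> Ck_at k f x -> Ck_at k (g \o f) x.
Proof.
move=> cg cf; apply/Ck_at_rowP => j.
by apply: (@Ck_at_comp _ _ (fun q => g q 0 j)) cf; exact: Ck_at_entry.
Qed.

End CkAtComp.

(** The equation [f x = y] is a hypothesis because a transition such as [c \o cinv a] reaches the
    point [c x] only after rewriting with [cfunK]. *)
Lemma diff_diff (R : realType) (U V W : normedModType R) (f : U -> V) (g : V -> W)
    x y v : f x = y -> differentiable f x -> differentiable g y ->
  'd g y ('d f x v) = 'D_v (g \o f) x.
Proof.
move=> <- df dg; rewrite deriveE; last exact: differentiable_comp.
have := diff_comp df dg => ->.
by [].
Qed.

(** * Symmetry of second derivatives *)

Section Schwarz.
Context {R : realType} {V : normedModType R}.
Implicit Types (F : V -> R) (x y u v : V) (h e : R).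

Lemma is_derive_line F y u s : differentiable F (y + s *: u) ->
  is_derive s 1 (fun t => F (y + t *: u)) ('D_u F (y + s *: u)).
Proof.
move=> dF.
have dl : is_diff s (fun t : R => y + t *: u) ( *:%R ^~ u).
  have := is_diffD (is_diff_cst y s) (is_diff_scalel s u).
  by rewrite add0r.
have dc : differentiable (F \o (fun t : R => y + t *: u)) s.
  exact: differentiable_comp.
apply: DeriveDef; first exact: diff_derivable.
by have [ddl El] := dl; rewrite deriveE// diff_comp//= El scale1r deriveE.
Qed.

Lemma MVT_line F y u h : 0 < h ->
  (forall s, 0 <= s <= h -> differentiable F (y + s *: u)) ->
  exists2 c, 0 <= c <= h & F (y + h *: u) - F y = 'D_u F (y + c *: u) * h.
Proof.
move=> h0 dF.
have [||c ch E] := @MVT R (fun t => F (y + t *: u))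
    (fun s => 'D_u F (y + s *: u)) _ _ h0.
- move=> s; rewrite in_itv/= => /andP[s0 sh]; apply/is_derive_line/dF.
  by rewrite (ltW s0) (ltW sh).
- apply: derivable_within_continuous => s; rewrite in_itv/= => sh.
  by have [] := is_derive_line (dF s sh).
exists c; first by move: ch; rewrite in_itv/= => /andP[/ltW-> /ltW->].
by move: E; rewrite scale0r addr0 subr0.
Qed.

(** Two applications of the mean value theorem turn the second difference into [h * h] times
    ['D_v ('D_u F)] at a point of the parallelogram spanned by [h *: u] and [h *: v]; continuity of
    this derivative at [x] bounds the error. *)
Lemma second_difference F x u v e : Ck_at 2 F x -> 0 < e ->
  \forall h \near 0^'+,
    `|F (x + h *: u + h *: v) - F (x + h *: u) - (F (x + h *: v) - F x)
      - 'D_v ('D_u F) x * h * h| <= e * h * h.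
Proof.
case=> dF /(_ u)[dDF /(_ v) cDF] e0.
have cF : \forall y \near x, `|'D_v ('D_u F) x - 'D_v ('D_u F) y| < e.
  have cF' : 'D_v ('D_u F) y @[y --> x] --> 'D_v ('D_u F) x.
    exact: (nbhs_singleton cDF).
  by move/cvgrPdist_lt : cF'; exact.
have : \forall y \near x, differentiable F y /\ (differentiable ('D_u F) y /\
    `|'D_v ('D_u F) x - 'D_v ('D_u F) y| < e).
  exact: filterI dF (filterI dDF cF).
move=> /nbhs_ballP[r /= r0 H].
(* The summand [1] keeps the divisor positive when [u] and [v] both vanish. *)
have k0 : 0 < `|u| + `|v| + 1 by rewrite ltr_wpDl// addr_ge0.
near=> h.
have h0 : 0 < h by near: h; exact: nbhs_right_gt.
have hr : h * (`|u| + `|v| + 1) < r.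
  rewrite -ltr_pdivlMr//; near: h; apply: nbhs_right_lt; exact: divr_gt0.
have inb (s t : R) : 0 <= s <= h -> 0 <= t <= h -> ball x r (x + s *: u + t *: v).
  move=> /andP[s0 sh] /andP[t0 th]; rewrite -ball_normE /= -addrA opprD addNKr.
  rewrite normrN (le_lt_trans (ler_normD _ _))// !normrZ !ger0_norm//.
  apply: le_lt_trans hr; rewrite 2!mulrDr mulr1.
  apply: ler_wpDr; first exact: ltW.
  by apply: lerD; exact: ler_wpM2r.
have h00 : 0 <= (0 : R) <= h by rewrite lexx ltW.
have h1 : 0 <= h <= h by rewrite lexx ltW.
have [s sh E1] : exists2 c, 0 <= c <= h &
    (F (x + h *: u + h *: v) - F (x + h *: u)) - (F (x + h *: v) - F x)
    = ('D_u F (x + c *: u + h *: v) - 'D_u F (x + c *: u)) * h.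
  (* The first mean value is taken along [u], on the increment of [F] in the direction [h *: v]; the
     second one is taken along [v], on ['D_u F]. *)
  pose K y := F (y + h *: v) - F y.
  have dK s : 0 <= s <= h -> is_diff (x + s *: u) K
      ('d F (x + s *: u + h *: v) \- 'd F (x + s *: u)).
    move=> sh; have [d1 _] := H _ (inb s h sh h1).
    have [d0 _] := H _ (inb s 0 sh h00); rewrite scale0r addr0 in d0.
    have dsh : is_diff (x + s *: u) (fun y => y + h *: v) id.
      have := is_diffD (is_diff_id (x + s *: u)) (is_diff_cst (h *: v) (x + s *: u)).
      by rewrite addr0.
    have dc : is_diff (x + s *: u) (F \o (fun y => y + h *: v))
        ('d F (x + s *: u + h *: v)).
      exact: (is_diff_comp dsh (differentiableP d1)).
    exact: (is_diffB dc (differentiableP d0)).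
  have [|c ch E] := @MVT_line K x u h h0; first by move=> s /dK[].
  exists c => //; rewrite [RHS](_ : _ = 'D_u K (x + c *: u) * h).
    by rewrite -E /K -!addrA [h *: u + _]addrC.
  have [d1 _] := H _ (inb c h ch h1).
  have [d0 _] := H _ (inb c 0 ch h00); rewrite scale0r addr0 in d0.
  have dKc := dK c ch.
  by rewrite [in RHS]deriveE// diff_val !deriveE.
have [|t th E2] := @MVT_line ('D_u F) (x + s *: u) v h h0.
  by move=> t th; have [_ []] := H _ (inb s t sh th).
rewrite E1 E2 -!mulrBl !normrM (gtr0_norm h0).
apply: ler_wpM2r; first exact: ltW.
apply: ler_wpM2r; first exact: ltW.
have [_ [_ /ltW D2]] := H _ (inb s t sh th).
rewrite distrC.
exact: D2.
Unshelve. all: by end_near. Qed.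

(** The second difference is symmetric in [u] and [v], so for small [h] the same quotient
    approximates both iterated derivatives, each within [e / 2]. *)
Lemma derive_comm F x u v : Ck_at 2 F x -> 'D_v ('D_u F) x = 'D_u ('D_v F) x.
Proof.
move=> cF; apply/eqP; rewrite -subr_eq0 -normr_le0; apply/ler_addgt0Pl => e e0.
rewrite addr0.
have e20 : 0 < e / 2 by rewrite divr_gt0.
have S1 := @second_difference F x u v _ cF e20.
have S2 := @second_difference F x v u _ cF e20.
have h00 : \forall h \near (0 : R)^'+, 0 < h by exact: nbhs_right_gt.
have [h [h0 [H1 H2]]] := @filter_ex _ _ (at_right_proper_filter (0 : R)) _
  (filterI h00 (filterI S1 S2)).
have addE : x + h *: v + h *: u = x + h *: u + h *: v by exact: addrAC.
rewrite addE in H2; clear addE S1 S2 h00.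
move: H1 H2; move: (F _) (F _) (F _) (F _) ('D_v _ x) ('D_u _ x) => a b c d p q H1 H2.
rewrite -(ler_pM2r h0) -(ler_pM2r h0).
have -> : `|p - q| * h * h = `|(p - q) * h * h|.
  by rewrite !normrM (gtr0_norm h0).
have -> : e * h * h = e / 2 * h * h + e / 2 * h * h by field.
apply: le_trans (lerD H2 H1); apply: le_trans (ler_normB _ _).
by rewrite le_eqVlt; apply/orP; left; apply/eqP; congr `|_|; ring.
Qed.

End Schwarz.

(** * Smooth germs and linear systems with smooth coefficients *)

Section SmoothAt.
Context {R : realType} {V : normedModType R}.
Implicit Types (x v : V).

Lemma smooth_at_cst (W : normedModType R) (w : W) x : smooth_at (fun=> w) x.
Proof. by move=> k; exact: Ck_at_cst. Qed.

Lemma smooth_atD (W : normedModType R) (f g : V -> W) x :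
  smooth_at f x -> smooth_at g x -> smooth_at (fun y => f y + g y) x.
Proof. by move=> sf sg k; exact: Ck_atD. Qed.

Lemma smooth_at_sum (W : normedModType R) (I : Type) (s : seq I)
    (F : I -> V -> W) x :
  (forall i, smooth_at (F i) x) -> smooth_at (fun y => \sum_(i <- s) F i y) x.
Proof. by move=> sF k; apply: Ck_at_sum => i; exact: sF. Qed.

Lemma smooth_atM (f g : V -> R) x :
  smooth_at f x -> smooth_at g x -> smooth_at (fun y => f y * g y) x.
Proof. by move=> sf sg k; exact: Ck_atM. Qed.

Lemma smooth_at_prod (I : Type) (s : seq I) (F : I -> V -> R) x :
  (forall i, smooth_at (F i) x) -> smooth_at (fun y => \prod_(i <- s) F i y) x.
Proof. by move=> sF k; apply: Ck_at_prod => i; exact: sF. Qed.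

Lemma smooth_at_inv (f : V -> R) x :
  f x != 0 -> smooth_at f x -> smooth_at (fun y => (f y)^-1) x.
Proof. by move=> f0 sf k; exact: Ck_at_inv. Qed.

Lemma smooth_at_entry m n (f : V -> 'M[R]_(m, n)) x i j :
  smooth_at f x -> smooth_at (fun y => f y i j) x.
Proof. by move=> sf k; exact: Ck_at_entry. Qed.

Lemma smooth_at_row n (f : V -> 'rV[R]_n) x :
  (forall j, smooth_at (fun y => f y 0 j) x) -> smooth_at f x.
Proof. by move=> sf k; apply/Ck_at_rowP => j; exact: sf. Qed.

Lemma smooth_at_comp n p (g : 'rV[R]_n -> 'rV[R]_p) (f : V -> 'rV[R]_n) x :
  smooth_at g (f x) -> smooth_at f x -> smooth_at (g \o f) x.
Proof. by move=> sg sf k; exact: Ck_at_comp_row. Qed.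

Lemma smooth_atZ n (a : V -> R) (f : V -> 'rV[R]_n) x :
  smooth_at a x -> smooth_at f x -> smooth_at (fun y => a y *: f y) x.
Proof.
move=> sa sf; apply: smooth_at_row => j.
have -> : (fun y => (a y *: f y) 0 j) = (fun y => a y * f y 0 j).
  by apply/funext => y; rewrite mxE.
by apply: smooth_atM sa _; exact: smooth_at_entry.
Qed.

Lemma smooth_at_det n (A : V -> 'M[R]_n) x :
  (forall i j, smooth_at (fun y => A y i j) x) ->
  smooth_at (fun y => \det (A y)) x.
Proof.
move=> sA; apply: smooth_at_sum => s; apply: smooth_atM.
  exact: smooth_at_cst.
by apply: smooth_at_prod => i; exact: sA.
Qed.

(** Cramer's rule: the determinant stays nonzero near [x], and the adjugate has entries polynomial
    in those of [A]. *)
Lemma smooth_at_solve n (A : V -> 'M[R]_n) (b Y : V -> 'rV[R]_n) x :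
  (forall i j, smooth_at (fun y => A y i j) x) -> smooth_at b x ->
  A x \in unitmx -> (\forall y \near x, Y y *m A y = b y) -> smooth_at Y x.
Proof.
move=> sA sb; rewrite unitmxE unitfE => Ax0 YA.
have sd := smooth_at_det sA.
apply: (@near_eq_smooth_at _ _ _
  (fun y => (\det (A y))^-1 *: (b y *m \adj (A y)))).
  have d0 : \forall y \near x, \det (A y) != 0.
    exact: (cvgr_neq0 _ (smooth_at_continuous sd)).
  apply: filterS2 d0 YA => y d0 <-.
  by rewrite -mulmxA mul_mx_adj mul_mx_scalar scalerA mulVf// scale1r.
apply: smooth_atZ; first exact: smooth_at_inv.
apply: smooth_at_row => j.
have -> : (fun y => (b y *m \adj (A y)) 0 j)
    = (fun y => \sum_k b y 0 k * \adj (A y) k j).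
  by apply/funext => y; rewrite mxE.
apply: smooth_at_sum => k; apply: smooth_atM; first exact: smooth_at_entry.
have -> : (fun y => \adj (A y) k j)
    = (fun y => (-1) ^+ (j + k) * \det (row' j (col' k (A y)))).
  by apply/funext => y; rewrite mxE.
apply: smooth_atM; first exact: smooth_at_cst.
apply: smooth_at_det => i l.
have -> : (fun y => row' j (col' k (A y)) i l) = (fun y => A y (lift j i) (lift k l)).
  by apply/funext => y; rewrite !mxE.
exact: sA.
Qed.

End SmoothAt.

(** * Differentials along fields and Lie brackets in coordinates *)

Section DiffAlong.
Context {R : realType} {m p : nat}.
Implicit Types (F : 'rV[R]_m -> 'rV[R]_p) (X Y : 'rV[R]_m -> 'rV[R]_m).
Implicit Types (x w : 'rV[R]_m).

Lemma diff_along_entry F Y y j : differentiable F y ->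
  'd F y (Y y) 0 j
  = \sum_i Y y 0 i * 'D_(delta_mx 0 i) (fun z => F z 0 j) y.
Proof.
move=> dF; rewrite diff_row_sum// summxE; apply: eq_bigr => i _.
by rewrite mxE derive_entry.
Qed.

Lemma smooth_at_diff_along F Y x : smooth_at F x -> smooth_at Y x ->
  smooth_at (fun y => 'd F y (Y y)) x.
Proof.
move=> sF sY; apply: smooth_at_row => j.
apply: (@near_eq_smooth_at _ _ _ (fun y =>
    \sum_i Y y 0 i * 'D_(delta_mx 0 i) (fun z => F z 0 j) y)).
  by apply: filterS (smooth_at_near_diff sF) => y dF; rewrite diff_along_entry.
apply: smooth_at_sum => i; apply: smooth_atM; first exact: smooth_at_entry.
by apply: smooth_at_deriv; exact: smooth_at_entry.
Qed.

(** Product rule: one term differentiates [Y], and the double sum is the second derivative of [F]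
    evaluated on [w] and [Y x]. *)
Lemma derive_diff_along F Y x w j : smooth_at F x -> smooth_at Y x ->
  'D_w (fun y => 'd F y (Y y)) x 0 j = 'd F x ('D_w Y x) 0 j +
  \sum_i \sum_k w 0 i * Y x 0 k *
    'D_(delta_mx 0 i) ('D_(delta_mx 0 k) (fun z => F z 0 j)) x.
Proof.
move=> sF sY; have sFj := smooth_at_entry 0 j sF.
pose e i : 'rV[R]_m := delta_mx 0 i.
have dFe k : differentiable ('D_(e k) (fun z => F z 0 j)) x.
  by apply: smooth_at_diff; exact: smooth_at_deriv.
have dY := smooth_at_diff sY; have dFx := smooth_at_diff sF.
have dYk k : differentiable (fun y => Y y 0 k) x by exact: differentiable_entry.
have dsum : is_derive x w
    (\sum_k ((fun y => Y y 0 k) * 'D_(e k) (fun z => F z 0 j)))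
    (\sum_k (Y x 0 k *: 'D_w ('D_(e k) (fun z => F z 0 j)) x
       + 'D_(e k) (fun z => F z 0 j) x *: 'D_w (fun y => Y y 0 k) x)).
  apply: is_derive_sum => k; apply: is_deriveM; apply: derivableP;
    exact: diff_derivable.
have nE : \forall y \near x, 'd F y (Y y) 0 j =
    (\sum_k ((fun y => Y y 0 k) * 'D_(e k) (fun z => F z 0 j))) y.
  apply: filterS (smooth_at_near_diff sF) => y dF.
  by rewrite diff_along_entry// fct_sumE.
rewrite -derive_entry; last exact/smooth_at_diff/smooth_at_diff_along.
rewrite (near_eq_deriv w nE) derive_val big_split/= addrC; congr (_ + _).
  rewrite (diff_along_entry (fun=> 'D_w Y x))//.
  by apply: eq_bigr => k _; rewrite (derive_entry w 0 k dY); exact: mulrC.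
rewrite exchange_big/=; apply: eq_bigr => k _.
rewrite deriveE// diff_row_sum// scaler_sumr; apply: eq_bigr => i _.
by rewrite [w 0 i * _]mulrC -mulrA; congr (_ * _).
Qed.

(** Naturality of the bracket: the two second-derivative terms of [F] agree by [derive_comm] and
    cancel. *)
Lemma diff_bracket F X Y x : smooth_at F x -> smooth_at X x -> smooth_at Y x ->
  'd F x ('D_(X x) Y x - 'D_(Y x) X x)
  = 'D_(X x) (fun y => 'd F y (Y y)) x - 'D_(Y x) (fun y => 'd F y (X y)) x.
Proof.
move=> sF sX sY; apply/rowP => j.
have S : \sum_i \sum_k X x 0 i * Y x 0 k *
      'D_(delta_mx 0 i) ('D_(delta_mx 0 k) (fun z => F z 0 j)) x
    = \sum_i \sum_k Y x 0 i * X x 0 k *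
      'D_(delta_mx 0 i) ('D_(delta_mx 0 k) (fun z => F z 0 j)) x.
  rewrite exchange_big/=; apply: eq_bigr => i _; apply: eq_bigr => k _.
  have := @derive_comm _ _ (fun z => F z 0 j) x (delta_mx 0 i) (delta_mx 0 k)
    (smooth_at_entry 0 j sF 2).
  move: ('D__ ('D__ _) x) ('D__ ('D__ _) x) => a b ->.
  by rewrite [X x 0 k * _]mulrC.
have := derive_diff_along (X x) j sF sY.
have := derive_diff_along (Y x) j sF sX.
rewrite S; move: (\sum_i _) => {}S.
move: ('D_(X x) Y x) ('D_(Y x) X x) => a b.
move: ('D_(X x) (fun y => 'd F y (Y y)) x) ('D_(Y x) (fun y => 'd F y (X y)) x).
move=> c d Ed Ec.
by rewrite linearB !mxE Ec Ed opprD addrACA subrr addr0.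
Qed.

End DiffAlong.

(** * Charts, vector fields and metrics *)

Section ChartTopology.
Context {R : realType} {m : nat} {M : topologicalType}.
Implicit Types (c d : chart R m M) (x : M) (A : set M).

(** Carries a property valid near [x] into the chart; the identity [c (cinv c p) = p] comes from the
    openness of the chart image. *)
Lemma near_cinv c x A : cdom c x -> nbhs x A ->
  \forall p \near c x, [/\ cdom c (cinv c p), A (cinv c p) & c (cinv c p) = p].
Proof.
move=> cx Ax; have icx : (c @` cdom c) (c x) by exists x.
have cA : \forall p \near c x, A (cinv c p).
  by apply: (cinv_cont icx); rewrite /= cfunK.
apply: filterS2 cA (open_nbhs_nbhs (conj (@cimg_open _ _ _ c) icx)) => p Ap [y cy yp].
by rewrite -yp in Ap *; rewrite cfunK//; rewrite cfunK// in Ap.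
Qed.

Lemma open_cimg c A : open A -> A `<=` cdom c -> open (c @` A).
Proof.
move=> oA Ac; rewrite openE => _ [x Ax <-].
apply: filterS (near_cinv (Ac _ Ax) (open_nbhs_nbhs (conj oA Ax))) => p [_ Ap cp].
by exists (cinv c p).
Qed.

Lemma smooth_transition_at c d x : smooth_transition c d ->
  cdom c x -> cdom d x -> smooth_at (d \o cinv c) (c x).
Proof.
move=> cd cx dx; have oI := openI (@cdom_open _ _ _ c) (@cdom_open _ _ _ d).
by apply: (smooth_onP _ (open_cimg oI (@subIsetl _ _ _))).1 => //; exists x.
Qed.

End ChartTopology.

(** * Tangent vectors and smooth fields in charts *)

Section TangentVectors.
Context {R : realType} {m : nat} {M : manifold R m}.
Implicit Types (c d : chart R m M) (x : M) (v e : 'rV[R]_m) (X Y : vfield M).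

Lemma chart_at_atlas x : atlas (chart_at x).
Proof. exact: (s2valP (cid2 (atlas_cover x))). Qed.

Lemma cdom_chart_at x : cdom (chart_at x) x.
Proof. exact: (s2valP' (cid2 (atlas_cover x))). Qed.
Hint Resolve chart_at_atlas cdom_chart_at : core.

Lemma atlas_compatible c : atlas c -> compatible_chart c.
Proof. by move=> ac d ad; split; exact: atlas_smooth. Qed.

(** The two transition maps compose to the identity near [d x], and the chain rule differentiates
    this. *)
Lemma diff_transitionK c d x v : smooth_transition c d -> smooth_transition d c ->
  cdom c x -> cdom d x ->
  'd (d \o cinv c) (c x) ('d (c \o cinv d) (d x) v) = v.
Proof.
move=> cd dc cx dx.
have s1 := smooth_at_diff (smooth_transition_at cd cx dx).
have s2 := smooth_at_diff (smooth_transition_at dc dx cx).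
have e0 : (c \o cinv d) (d x) = c x by rewrite /= cfunK.
have E : \forall p \near d x, (d \o cinv c \o (c \o cinv d)) p = id p.
  have := near_cinv dx (open_nbhs_nbhs (conj (@cdom_open _ _ _ c) cx)).
  by apply: filterS => p [_ cp dp] /=; rewrite cfunK.
rewrite (diff_diff v e0 s2 s1).
by rewrite (near_eq_deriv v E) derive_id.
Qed.

Lemma tcoordK c x v : compatible_chart c -> cdom c x -> tvec c x (tcoord c x v) = v.
Proof.
by move=> /(_ _ (chart_at_atlas x))[s1 s2] cx; exact: diff_transitionK.
Qed.

Lemma tvecK c x e : compatible_chart c -> cdom c x -> tcoord c x (tvec c x e) = e.
Proof.
by move=> /(_ _ (chart_at_atlas x))[s1 s2] cx; exact: diff_transitionK.
Qed.

Lemma tcoord_chart_at x v : tcoord (chart_at x) x v = v.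
Proof.
have E : \forall p \near chart_at x x, (chart_at x \o cinv (chart_at x)) p = id p.
  by apply: filterS (near_cinv (cdom_chart_at x) filterT) => p [_ _].
rewrite /tcoord -deriveE.
  by rewrite (near_eq_deriv v E) derive_id.
apply: near_eq_differentiable (filterS _ E) _ => [p ->|] //.
Qed.

Lemma tcoord_linear c x (a : R) u v :
  tcoord c x (a *: u + v) = a *: tcoord c x u + tcoord c x v.
Proof. exact: linearP. Qed.

Lemma tvec_row_sum c x e : tvec c x e = \sum_i e 0 i *: tvec c x (delta_mx 0 i).
Proof.
rewrite {1}[e]row_sum_delta /tvec linear_sum.
by apply: eq_bigr => i _; rewrite linearZ.
Qed.

Lemma smooth_vf_at c X x : smooth_vf X -> atlas c -> cdom c x ->
  smooth_at (vf_rep c X) (c x).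
Proof.
by move=> sX ac cx; apply: (smooth_onP _ (@cimg_open _ _ _ c)).1 (sX _ ac) _ _; exists x.
Qed.

Lemma smooth_vfP X : (forall c x, atlas c -> cdom c x -> smooth_at (vf_rep c X) (c x)) ->
  smooth_vf X.
Proof.
move=> sX c ac; apply/(smooth_onP _ (@cimg_open _ _ _ c)) => _ [x cx <-].
exact: sX.
Qed.

Lemma smooth_fun_at c f x : smooth_fun f -> atlas c -> cdom c x ->
  smooth_at (f \o cinv c) (c x).
Proof.
by move=> sf ac cx; apply: (smooth_onP _ (@cimg_open _ _ _ c)).1 (sf _ ac) _ _; exists x.
Qed.

Lemma smooth_funP (f : M -> R) :
  (forall c x, atlas c -> cdom c x -> smooth_at (f \o cinv c) (c x)) -> smooth_fun f.
Proof.
move=> sf c ac; apply/(smooth_onP _ (@cimg_open _ _ _ c)) => _ [x cx <-].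
exact: sf.
Qed.

Lemma smooth_fun_cst (a : R) : smooth_fun (fun _ : M => a).
Proof. by apply: smooth_funP => c x _ _; exact: smooth_at_cst. Qed.

Lemma smooth_vf0 : smooth_vf (fun _ : M => 0 : 'rV[R]_m).
Proof.
apply: smooth_vfP => c x _ _.
have -> : vf_rep c (fun _ : M => 0) = fun=> 0.
  by apply/funext => p; exact: linear0.
exact: smooth_at_cst.
Qed.

Lemma smooth_vf_lin (f : M -> R) X Y : smooth_fun f -> smooth_vf X -> smooth_vf Y ->
  smooth_vf (fun x => f x *: X x + Y x).
Proof.
move=> sf sX sY; apply: smooth_vfP => c x ac cx.
have -> : vf_rep c (fun x => f x *: X x + Y x)
    = fun p => (f \o cinv c) p *: vf_rep c X p + vf_rep c Y p.
  by apply/funext => p; exact: tcoord_linear.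
apply: smooth_atD (smooth_vf_at sY ac cx); apply: smooth_atZ (smooth_vf_at sX ac cx).
exact: smooth_fun_at.
Qed.

Lemma smooth_vfB X Y : smooth_vf X -> smooth_vf Y -> smooth_vf (fun x => X x - Y x).
Proof.
move=> sX sY.
have -> : (fun x => X x - Y x) = (fun x => -1 *: Y x + X x).
  by apply/funext => x; rewrite scaleN1r addrC.
exact: smooth_vf_lin (smooth_fun_cst _) sY sX.
Qed.

End TangentVectors.

(** * Algebra and smoothness of a Riemannian metric *)

Section Metric.
Context {R : realType} {m : nat} {M : manifold R m} (g : riem_metric M).
Implicit Types (x : M) (u v w : 'rV[R]_m) (X Y : vfield M).

Lemma metricDl x u v w : g x (u + v) w = g x u w + g x v w.
Proof. by have := Defs.metric_linear g x w 1 u v; rewrite scale1r mul1r. Qed.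

Lemma metric0l x w : g x 0 w = 0.
Proof. by apply: (addIr (g x 0 w)); rewrite -metricDl addr0 add0r. Qed.

Lemma metricZl x (a : R) u w : g x (a *: u) w = a * g x u w.
Proof. by have := Defs.metric_linear g x w a u 0; rewrite addr0 metric0l addr0. Qed.

Lemma metricNl x u w : g x (- u) w = - g x u w.
Proof. by rewrite -scaleN1r metricZl mulN1r. Qed.

Lemma metricBl x u v w : g x (u - v) w = g x u w - g x v w.
Proof. by rewrite metricDl metricNl. Qed.

Lemma metricDr x u v w : g x w (u + v) = g x w u + g x w v.
Proof. by rewrite !(Defs.metric_sym g x w) metricDl. Qed.

Lemma metric0r x w : g x w 0 = 0.
Proof. by rewrite Defs.metric_sym metric0l. Qed.

Lemma metricZr x (a : R) u w : g x w (a *: u) = a * g x w u.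
Proof. by rewrite !(Defs.metric_sym g x w) metricZl. Qed.

Lemma metricNr x u w : g x w (- u) = - g x w u.
Proof. by rewrite !(Defs.metric_sym g x w) metricNl. Qed.

Lemma metricBr x u v w : g x w (u - v) = g x w u - g x w v.
Proof. by rewrite metricDr metricNr. Qed.

Lemma metric_sumZl x k (a : 'I_k -> R) (F : 'I_k -> 'rV[R]_m) w :
  g x (\sum_i a i *: F i) w = \sum_i a i * g x (F i) w.
Proof.
elim/big_rec2: _ => [|i y1 y2 _ <-]; first exact: metric0l.
by rewrite metricDl metricZl.
Qed.

Lemma metric_eq0 x v : g x v v = 0 -> v = 0.
Proof.
move=> gv; apply/eqP; apply/negPn/negP => v0.
by have := Defs.metric_pos g x v0; rewrite gv ltxx.
Qed.

Lemma metric_expand c x u v : compatible_chart c -> cdom c x ->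
  g x u v = \sum_i tcoord c x u 0 i * \sum_j tcoord c x v 0 j *
    g x (tvec c x (delta_mx 0 i)) (tvec c x (delta_mx 0 j)).
Proof.
move=> cc cx; rewrite -{1}(tcoordK u cc cx) tvec_row_sum.
rewrite (metric_sumZl x (fun i => tcoord c x u 0 i) (fun i => tvec c x (delta_mx 0 i))).
apply: eq_bigr => i _; congr (_ * _).
rewrite -{1}(tcoordK v cc cx) [tvec c x (tcoord c x v)]tvec_row_sum Defs.metric_sym.
rewrite (metric_sumZl x (fun j => tcoord c x v 0 j) (fun j => tvec c x (delta_mx 0 j))).
by apply: eq_bigr => j _; rewrite Defs.metric_sym.
Qed.

(** The sum is the [i]-th component of the covector dual to [X]; for [X = xi] it becomes a column of
    the linear system that determines [phi X]. *)
Lemma smooth_at_metric_covector c x X i : atlas c -> cdom c x -> smooth_vf X ->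
  smooth_at (fun p => \sum_j vf_rep c X p 0 j *
    g (cinv c p) (tvec c (cinv c p) (delta_mx 0 i)) (tvec c (cinv c p) (delta_mx 0 j)))
    (c x).
Proof.
move=> ac cx sX; apply: smooth_at_sum => j; apply: smooth_atM.
  by apply: smooth_at_entry; exact: smooth_vf_at.
have := metric_smooth g (delta_mx 0 i) (delta_mx 0 j) ac.
by move=> /(smooth_onP _ (@cimg_open _ _ _ c)); apply; exists x.
Qed.

Lemma smooth_fun_metric X Y : smooth_vf X -> smooth_vf Y ->
  smooth_fun (fun x => g x (X x) (Y x)).
Proof.
move=> sX sY; apply: smooth_funP => c x ac cx.
apply: (@near_eq_smooth_at _ _ _ (fun p => \sum_i vf_rep c X p 0 i *
   \sum_j vf_rep c Y p 0 j *
    g (cinv c p) (tvec c (cinv c p) (delta_mx 0 i)) (tvec c (cinv c p) (delta_mx 0 j)))).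
  apply: filterS (near_cinv cx filterT) => p [cp _ _].
  by rewrite /= (metric_expand _ _ (atlas_compatible ac) cp).
apply: smooth_at_sum => i; apply: smooth_atM.
  by apply: smooth_at_entry; exact: smooth_vf_at.
exact: smooth_at_metric_covector.
Qed.

End Metric.

(** * The differential of a smooth map in arbitrary charts *)

Section MapDifferential.
Context {R : realType} {m p : nat} {M : manifold R m} {N : manifold R p}.
Context (f : M -> N) (sf : smooth_map f).
Implicit Types (c : chart R m M) (d : chart R p N) (x : M) (v : 'rV[R]_m).

Let cont_f : continuous f := sf.1.

Lemma near_cdom_preimage d x : cdom d (f x) -> \forall y \near x, cdom d (f y).
Proof.
by move=> dfx; apply: cont_f; exact: open_nbhs_nbhs (conj (@cdom_open _ _ _ d) dfx).
Qed.

(** Passing through the atlas chart at [f x] extends smoothness to all compatible charts of [N], as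
    required for the holomorphic ones. *)
Lemma smooth_map_at c d x : atlas c -> cdom c x -> compatible_chart d ->
  cdom d (f x) -> smooth_at (d \o f \o cinv c) (c x).
Proof.
move=> ac cx cd dfx; pose b := chart_at (f x).
have ab : atlas b by exact: chart_at_atlas.
have bfx : cdom b (f x) by exact: cdom_chart_at.
have sb : smooth_at (b \o f \o cinv c) (c x).
  have oU : open (cdom c `&` f @^-1` cdom b).
    apply: openI; first exact: cdom_open.
    by apply: open_comp => //; exact: cdom_open.
  by apply: (smooth_onP _ (open_cimg oU (@subIsetl _ _ _))).1 (sf.2 _ _ ac ab) _ _; exists x.
apply: (@near_eq_smooth_at _ _ _ ((d \o cinv b) \o (b \o f \o cinv c))).
  apply: filterS (near_cinv cx (near_cdom_preimage bfx)) => q [_ bq _] /=.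
  by rewrite cfunK.
apply: smooth_at_comp sb; rewrite /= cfunK//.
by apply: smooth_transition_at => //; exact: (cd _ ab).2.
Qed.

(** By the chain rule both sides are derivatives of the same local map, [d \o f] read in the
    preferred chart at [x]. *)
Lemma diff_dmap c d x v : atlas c -> cdom c x -> compatible_chart d ->
  cdom d (f x) -> 'd (d \o f \o cinv c) (c x) (tcoord c x v) = tcoord d (f x) (dmap f x v).
Proof.
move=> ac cx cd dfx; pose a := chart_at x; pose b := chart_at (f x).
have aa : atlas a by exact: chart_at_atlas.
have ax : cdom a x by exact: cdom_chart_at.
have ab : atlas b by exact: chart_at_atlas.
have bfx : cdom b (f x) by exact: cdom_chart_at.
have cb := atlas_compatible ab.
have s1 := smooth_at_diff (smooth_map_at ac cx cd dfx).
have s2 : differentiable (c \o cinv a) (a x).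
  apply: smooth_at_diff; apply: smooth_transition_at => //; exact: atlas_smooth.
have s3 := smooth_at_diff (smooth_map_at aa ax cb bfx).
have s4 : differentiable (d \o cinv b) (b (f x)).
  by apply: smooth_at_diff; apply: smooth_transition_at => //; exact: (cd _ ab).2.
have e1 : (c \o cinv a) (a x) = c x by rewrite /= cfunK.
have e2 : (b \o f \o cinv a) (a x) = b (f x) by rewrite /= cfunK.
apply: (etrans (diff_diff v e1 s2 s1)).
apply: (etrans _ (esym (diff_diff v e2 s3 s4))); apply: near_eq_deriv.
have nx : \forall y \near x, cdom c y /\ cdom b (f y).
  apply: filterI (near_cdom_preimage bfx).
  exact: open_nbhs_nbhs (conj (@cdom_open _ _ _ c) cx).
by apply: filterS (near_cinv ax nx) => q [_ [cq bq] _] /=; rewrite !cfunK.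
Qed.

End MapDifferential.

(** * The structure induced by a PHWC submersion *)

(** Rank-nullity: surjectivity forces rank [k], which leaves a kernel of dimension one, spanned by
    [u]. *)
Lemma ker_surjective_line (K : fieldType) (k : nat)
    (L : {linear 'rV[K]_k.+1 -> 'rV[K]_k}) (u v : 'rV[K]_k.+1) :
  (forall w, exists z, L z = w) -> u != 0 -> L u = 0 -> L v = 0 ->
  exists a, v = a *: u.
Proof.
move=> Ls u0 Lu Lv; pose A := lin1_mx L.
have rA : \rank A = k.
  apply/eqP; rewrite eqn_leq rank_leq_col /=.
  have : row_full A.
    rewrite -sub1mx; apply/row_subP => i.
    have [z Lz] := Ls (row i 1%:M); apply/submxP; exists z.
    by rewrite mul_rV_lin1.
  by rewrite /row_full => /eqP->.
have uk : (u <= kermx A)%MS by apply/sub_kermxP; rewrite mul_rV_lin1.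
have vk : (v <= kermx A)%MS by apply/sub_kermxP; rewrite mul_rV_lin1.
have ku : (kermx A <= u)%MS.
  rewrite -(geq_leqif (mxrank_leqif_sup uk)) mxrank_ker rA rank_rV u0.
  by rewrite subSn ?leqnn// subnn.
exact/sub_rVP/(submx_trans vk ku).
Qed.

Lemma unitmx_inj (K : fieldType) (k : nat) (A : 'M[K]_k) :
  (forall v : 'rV[K]_k, v *m A = 0 -> v = 0) -> A \in unitmx.
Proof.
move=> Ai; rewrite -row_free_unit -kermx_eq0; apply/rowV0P => v /sub_kermxP.
exact: Ai.
Qed.

(** * The standard complex structure as a constant linear map *)

Section StdComplex.
Context {R : realType} {n : nat}.
Implicit Types (u v : 'rV[R]_(n + n)).

Lemma std_complexB u v : std_complex (u - v) = std_complex u - std_complex v.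
Proof.
rewrite /std_complex opp_row_mx add_row_mx opprK.
have -> : rsubmx (u - v) = rsubmx u - rsubmx v by exact: linearB.
have -> : lsubmx (u - v) = lsubmx u - lsubmx v by exact: linearB.
by rewrite opprB addrC.
Qed.

Lemma std_complexK v : std_complex (std_complex v) = - v.
Proof.
rewrite /std_complex row_mxKl row_mxKr -[v in RHS]hsubmxK.
by rewrite opp_row_mx.
Qed.

Lemma smooth_at_std_complex (V : normedModType R) (b : V -> 'rV[R]_(n + n)) x :
  smooth_at b x -> smooth_at (fun y => std_complex (b y)) x.
Proof.
move=> sb; apply: smooth_at_row => j; case: (splitP j) => k jk.
  apply: (@near_eq_smooth_at _ _ _ (fun y => -1 * b y 0 (rshift n k))).
    near=> y; rewrite mxE; case: splitP => l; rewrite jk => kl.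
      by rewrite (ord_inj kl) !mxE mulN1r.
    by have := ltn_ord k; rewrite kl ltnNge leq_addr.
  apply: smooth_atM; first exact: smooth_at_cst.
  exact: smooth_at_entry.
apply: (@near_eq_smooth_at _ _ _ (fun y => b y 0 (lshift n k))).
  near=> y; rewrite mxE; case: splitP => l; rewrite jk => kl.
    by have := ltn_ord l; rewrite -kl ltnNge leq_addr.
  by rewrite (ord_inj (addnI kl)) !mxE.
exact: smooth_at_entry.
Unshelve. all: by end_near. Qed.

Lemma derive_std_complex (V : normedModType R) (b : V -> 'rV[R]_(n + n)) x w :
  smooth_at b x -> 'D_w (fun y => std_complex (b y)) x = std_complex ('D_w b x).
Proof.
move=> sb; have db := smooth_at_diff sb.
have dSb := smooth_at_diff (smooth_at_std_complex sb).
apply/rowP => j; rewrite -(derive_entry w 0 j dSb) mxE.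
case: splitP => k jk; rewrite !mxE -(derive_entry w 0 _ db).
  have -> : (fun y => std_complex (b y) 0 j) = - (fun y => b y 0 (rshift n k)).
    apply/funext => y; rewrite mxE; case: splitP => l; rewrite jk => kl.
      by rewrite (ord_inj kl) !mxE.
    by have := ltn_ord k; rewrite kl ltnNge leq_addr.
  apply: deriveN; apply: diff_derivable; exact: differentiable_entry.
have -> // : (fun y => std_complex (b y) 0 j) = (fun y => b y 0 (lshift n k)).
apply/funext => y; rewrite mxE; case: splitP => l; rewrite jk => kl.
  by have := ltn_ord l; rewrite -kl ltnNge leq_addr.
by rewrite (ord_inj (addnI kl)) !mxE.
Qed.

End StdComplex.

(** * Pointwise algebra of the induced structure *)

Section InducedAlgebra.
Context {R : realType} {n : nat} {M : manifold R (n + n).+1} {N : manifold R (n + n)}.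
Context {g : riem_metric M} {J : endo N} {h : riem_metric N} {f : M -> N}.
Context {phi : endo M} {xi : vfield M} {eta : M -> 'rV[R]_((n + n).+1) -> R}.
Context (hJ : hermitian_structure J h) (hf : submersion f) (hphwc : PHWC f g J h)
  (hind : induced_structure f g J phi xi eta).
Implicit Types (x : M) (u v w : 'rV[R]_((n + n).+1)) (E : 'rV[R]_(n + n)).

Lemma dmapB x u v : dmap f x (u - v) = dmap f x u - dmap f x v.
Proof. exact: linearB. Qed.

Lemma dmapD x u v : dmap f x (u + v) = dmap f x u + dmap f x v.
Proof. exact: linearD. Qed.

Lemma dmapN x v : dmap f x (- v) = - dmap f x v.
Proof. exact: linearN. Qed.

Lemma dmapZ x (a : R) v : dmap f x (a *: v) = a *: dmap f x v.
Proof. exact: linearZ. Qed.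

Lemma xi_neq0 x : xi x != 0.
Proof.
apply/eqP => x0; have := ind_xi_unit hind x.
by rewrite x0 metric0l => /esym/eqP; rewrite oner_eq0.
Qed.

(** The kernel of the differential is a line containing [xi x], and the unit length of [xi x] gives
    the coefficient. *)
Lemma verticalE x v : vertical f x v -> v = g x v (xi x) *: xi x.
Proof.
move=> vv; have [a va] := ker_surjective_line (hf.2 x) (xi_neq0 x)
  (ind_xi_vertical hind x) vv.
by rewrite {2}va metricZl (ind_xi_unit hind) mulr1.
Qed.

Lemma horizontalP x u : horizontal f g x u <-> g x u (xi x) = 0.
Proof.
split=> [hu|gu w /verticalE ->]; first exact/hu/(ind_xi_vertical hind).
by rewrite metricZr gu mulr0.
Qed.

Lemma horizontal_sub x v : horizontal f g x (v - g x v (xi x) *: xi x).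
Proof.
by apply/horizontalP; rewrite metricBl metricZl (ind_xi_unit hind) mulr1 subrr.
Qed.

Lemma horizontal_vertical_eq0 x u :
  horizontal f g x u -> vertical f x u -> u = 0.
Proof. by move=> hu /[dup] vu /verticalE ->; rewrite ((horizontalP x u).1 hu) scale0r. Qed.

(** Extends what is known of [phi] on horizontal vectors to all vectors, by removing the [xi]
    component. *)
Lemma phi_sub_xi x v (a : R) : phi x (v - a *: xi x) = phi x v.
Proof. by rewrite linearB linearZ/= (ind_phi_xi hind) scaler0 subr0. Qed.

Lemma metric_phi_xi x v : g x (phi x v) (xi x) = 0.
Proof.
rewrite -(@phi_sub_xi x v (g x v (xi x))); apply/horizontalP.
by have [] := ind_phi_horizontal hind (@horizontal_sub x v).
Qed.

Lemma dmap_xi x : dmap f x (xi x) = 0.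
Proof. exact: ind_xi_vertical hind x. Qed.

Lemma dmap_phi x v : dmap f x (phi x v) = J (f x) (dmap f x v).
Proof.
rewrite -(@phi_sub_xi x v (g x v (xi x))).
have [_ ->] := ind_phi_horizontal hind (@horizontal_sub x v).
by rewrite dmapB dmapZ dmap_xi scaler0 subr0.
Qed.

(** The two sides differ by a vector that is horizontal, and also vertical because [J] squares to
    minus the identity. *)
Lemma phi_phi x v : phi x (phi x v) = - v + g x v (xi x) *: xi x.
Proof.
apply/eqP; rewrite -subr_eq0; apply/eqP/(@horizontal_vertical_eq0 x).
  apply/horizontalP; rewrite metricBl metric_phi_xi metricDl metricNl metricZl.
  by rewrite (ind_xi_unit hind) mulr1 addNr subrr.
rewrite /vertical dmapB dmapD dmapN dmapZ dmap_xi !dmap_phi (herm_square hJ).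
by rewrite scaler0 addr0 subrr.
Qed.

(* The differential composed with its adjoint is injective, hence onto. *)
Lemma horizontal_adjoint x v : horizontal f g x v ->
  exists B : 'M[R]_(n + n, (n + n).+1), adjoint_at f g h x (mulmxr B) /\
    exists E, v = E *m B.
Proof.
move=> hv; have [A hA _] := hphwc x.
(* The values of the adjoint on the standard basis form a matrix, so that linearity is built in. *)
pose B := \matrix_(i < n + n) A (delta_mx 0 i).
have adjB X E : g x X (E *m B) = h (f x) (dmap f x X) E.
  rewrite mulmx_sum_row Defs.metric_sym metric_sumZl {2}[E]row_sum_delta.
  rewrite Defs.metric_sym metric_sumZl; apply: eq_bigr => i _.
  by rewrite rowK Defs.metric_sym hA Defs.metric_sym.
exists B; split=> //.
pose L : {linear _ -> _} :=
  'd (chart_at (f x) \o f \o cinv (chart_at x)) (chart_at x x).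
have hB E : horizontal f g x (E *m B).
  by move=> w vw; rewrite Defs.metric_sym adjB vw metric0l.
pose C := B *m lin1_mx L.
have EC E : E *m C = dmap f x (E *m B) by rewrite mulmxA mul_rV_lin1.
have uC : C \in unitmx.
  apply: unitmx_inj => E; rewrite EC => vE.
  have EB0 := horizontal_vertical_eq0 (hB E) vE.
  (* A preimage [X] of [E] turns [h (f x) E E] into [g x X (E *m B)], which is zero. *)
  have [X dX] := hf.2 x E.
  by apply: (@metric_eq0 _ _ _ h (f x)); rewrite -{1}dX -adjB EB0 metric0r.
exists (dmap f x v *m invmx C); apply/eqP; rewrite -subr_eq0; apply/eqP.
apply: (@horizontal_vertical_eq0 x).
  by move=> w vw; rewrite metricBl hv// hB// subrr.
by rewrite /vertical dmapB -EC mulmxKV// subrr.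
Qed.

(** Adjoints are unique since [g] is definite, so [B] inherits the commutation with [J] that [PHWC]
    asserts for [A]. *)
Lemma adjoint_complex x (B : 'M[R]_(n + n, (n + n).+1)) E :
  adjoint_at f g h x (mulmxr B) ->
  dmap f x (J (f x) E *m B) = J (f x) (dmap f x (E *m B)).
Proof.
move=> adjB; have [A hA AJ] := hphwc x.
have AB D : A D = D *m B.
  apply/eqP; rewrite -subr_eq0; apply/eqP/(@metric_eq0 _ _ _ g x).
  by rewrite metricBr hA -(adjB _ D) subrr.
by rewrite -!AB AJ.
Qed.

Lemma hermitian_skew y E E' : h y (J y E) E' = - h y E (J y E').
Proof. by rewrite -(herm_compat hJ y E) (herm_square hJ) metricNr opprK. Qed.

(** The horizontal part of [v] is the adjoint applied to some [E], and PHWC makes its image by [phi]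
    the adjoint applied to [J E]; the claim then reduces to the skewness of [J] for [h]. *)
Lemma phi_skew x u v : g x (phi x u) v = - g x u (phi x v).
Proof.
pose v' := v - g x v (xi x) *: xi x.
have hv' : horizontal f g x v' by exact: horizontal_sub.
have -> : g x (phi x u) v = g x (phi x u) v'.
  by rewrite metricBr metricZr metric_phi_xi mulr0 subr0.
rewrite -(@phi_sub_xi x v (g x v (xi x))) -/v'.
have [B [adjB [E vE]]] := horizontal_adjoint hv'.
have -> : phi x v' = J (f x) E *m B.
  apply/eqP; rewrite -subr_eq0; apply/eqP/(@horizontal_vertical_eq0 x).
    apply/horizontalP; rewrite metricBl metric_phi_xi Defs.metric_sym.
    by rewrite (adjB _ _) dmap_xi metric0l subrr.
  by rewrite /vertical dmapB dmap_phi adjoint_complex// vE subrr.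
rewrite vE (adjB _ E) (adjB _ (J (f x) E)) dmap_phi.
exact: hermitian_skew.
Qed.

End InducedAlgebra.

(** * Brackets of induced fields read in holomorphic charts *)

Section InducedCalculus.
Context {R : realType} {n : nat} {M : manifold R (n + n).+1} {N : manifold R (n + n)}.
Context {g : riem_metric M} {J : endo N} {h : riem_metric N} {f : M -> N}.
Context {phi : endo M} {xi : vfield M} {eta : M -> 'rV[R]_((n + n).+1) -> R}.
Context (hJ : hermitian_structure J h) (hf : submersion f) (hphwc : PHWC f g J h)
  (hind : induced_structure f g J phi xi eta).
Implicit Types (x : M) (c : chart R (n + n).+1 M) (d : chart R (n + n) N).
Implicit Types (X Y : vfield M).

Definition holomorphic_chart d := compatible_chart d /\
  forall z v, cdom d z -> tcoord d z (J z v) = std_complex (tcoord d z v).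

Lemma holomorphic_chart_at x : exists2 d, holomorphic_chart d & cdom d (f x).
Proof. by have [d [cd dfx Jd]] := herm_integrable hJ (f x); exists d. Qed.

Lemma diff_vf_rep c d x v : atlas c -> cdom c x -> compatible_chart d ->
    cdom d (f x) ->
  'd (d \o f \o cinv c) (c x) (tcoord c x v) = 0 -> vertical f x v.
Proof.
move=> ac cx cd dfx; have := diff_dmap hf.1 v ac cx cd dfx.
move: ('d _ _ _) => w -> E.
rewrite /vertical -(tcoordK (dmap f x v) cd dfx) E; exact: linear0.
Qed.

(** Stated on a neighbourhood, not only at the point, because both sides are differentiated in
    [derive_diff_phi]. *)
Lemma near_diff_vf_phi c d x X : atlas c -> cdom c x -> holomorphic_chart d ->
    cdom d (f x) ->
  \forall p \near c x, 'd (d \o f \o cinv c) p (vf_rep c (endo_app phi X) p)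
    = std_complex ('d (d \o f \o cinv c) p (vf_rep c X p)).
Proof.
move=> ac cx [cd Jd] dfx.
apply: filterS (near_cinv cx (near_cdom_preimage hf.1 dfx)) => p [cp dp cpp].
have := diff_dmap hf.1 (phi (cinv c p) (X (cinv c p))) ac cp cd dp.
have := diff_dmap hf.1 (X (cinv c p)) ac cp cd dp.
rewrite -/(vf_rep c X p) -/(vf_rep c (endo_app phi X) p) cpp.
move: ('d _ _ (vf_rep c X p)) => w ->.
move=> E; apply: (etrans E).
by rewrite (dmap_phi hf hind) Jd.
Qed.

Lemma near_diff_vf_xi c d x : atlas c -> cdom c x -> compatible_chart d ->
    cdom d (f x) ->
  \forall p \near c x, 'd (d \o f \o cinv c) p (vf_rep c xi p) = 0.
Proof.
move=> ac cx cd dfx.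
apply: filterS (near_cinv cx (near_cdom_preimage hf.1 dfx)) => p [cp dp cpp].
have := diff_dmap hf.1 (xi (cinv c p)) ac cp cd dp.
rewrite -/(vf_rep c xi p) cpp => E; apply: (etrans E).
by rewrite (dmap_xi hind); exact: linear0.
Qed.

(* [phi X] solves a square linear system with smooth coefficients: its image
   under the differential and its inner product with [xi] are prescribed. *)
Lemma smooth_phi X : smooth_vf X -> smooth_vf (endo_app phi X).
Proof.
move=> sX; apply: smooth_vfP => c x ac cx.
have [d hd dfx] := holomorphic_chart_at x; have [cd Jd] := hd.
have sG := smooth_map_at hf.1 ac cx cd dfx.
set G := d \o f \o cinv c in sG.
pose w i p : R := \sum_j vf_rep c xi p 0 j * g (cinv c p)
  (tvec c (cinv c p) (delta_mx 0 i)) (tvec c (cinv c p) (delta_mx 0 j)).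
have wE y u : cdom c y -> \sum_i tcoord c y u 0 i * w i (c y) = g y u (xi y).
  move=> cy; rewrite (metric_expand _ _ _ (atlas_compatible ac) cy).
  by apply: eq_bigr => i _; rewrite /w /vf_rep cfunK.
(* Column [ord0] pairs a vector with [xi], the other columns form the Jacobian of [G]; [b] lists the
   values prescribed for [phi X]. *)
pose A p : 'M[R]_((n + n).+1) := \matrix_(i, j)
  if unlift ord0 j is Some k then 'D_(delta_mx 0 i) G p 0 k else w i p.
pose b p : 'rV[R]_((n + n).+1) := \row_j
  if unlift ord0 j is Some k then std_complex ('d G p (vf_rep c X p)) 0 k else 0.
have vA p (v : 'rV[R]_((n + n).+1)) j : differentiable G p ->
    (v *m A p) 0 j = if unlift ord0 j is Some k then 'd G p v 0 k
                     else \sum_i v 0 i * w i p.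
  move=> dG; rewrite mxE; case: (unliftP ord0 j) => [k|] jE.
    rewrite (diff_row_sum v dG) summxE; apply: eq_bigr => i _.
    by rewrite !mxE jE liftK.
  by apply: eq_bigr => i _; rewrite mxE jE unlift_none.
apply: (@smooth_at_solve _ _ _ A b).
- move=> i j; case: (unliftP ord0 j) => [k|] jE.
    have -> : (fun y => A y i j) = (fun y => 'D_(delta_mx 0 i) G y 0 k).
      by apply/funext => p; rewrite mxE jE liftK.
    by apply: smooth_at_entry; exact: smooth_at_deriv.
  have -> : (fun y => A y i j) = w i.
    by apply/funext => p; rewrite mxE jE unlift_none.
  exact: (smooth_at_metric_covector g _ ac cx (ind_xi_smooth hind)).
- apply: smooth_at_row => j; case: (unliftP ord0 j) => [k|] jE.
    have -> : (fun y => b y 0 j)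
        = (fun y => std_complex ('d G y (vf_rep c X y)) 0 k).
      by apply/funext => p; rewrite mxE jE liftK.
    apply: smooth_at_entry; apply: smooth_at_std_complex.
    by apply: smooth_at_diff_along sG _; exact: smooth_vf_at.
  have -> : (fun y => b y 0 j) = (fun=> 0).
    by apply/funext => p; rewrite mxE jE unlift_none.
  exact: smooth_at_cst.
(* A vector killed by the system is vertical and orthogonal to [xi], hence zero. *)
- apply: unitmx_inj => v vA0.
  have dG := smooth_at_diff sG.
  have Gv : 'd G (c x) v = 0.
    apply/rowP => k; have := vA _ v (lift ord0 k) dG.
    by rewrite vA0 liftK => <-; rewrite !mxE.
  have gv : g x (tvec c x v) (xi x) = 0.
    rewrite -wE// tvecK//; last exact: atlas_compatible.
    by have := vA _ v ord0 dG; rewrite vA0 unlift_none => <-; rewrite mxE.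
  have vv : vertical f x (tvec c x v).
    apply: (diff_vf_rep ac cx cd dfx); rewrite tvecK//.
    exact: atlas_compatible.
  rewrite -(tvecK v (atlas_compatible ac) cx) (verticalE hf hind vv) gv scale0r.
  exact: linear0.
- have nG := smooth_at_near_diff sG.
  have nE := near_diff_vf_phi X ac cx hd dfx.
  have nc : \forall p \near c x, [/\ cdom c (cinv c p), True & c (cinv c p) = p].
    exact: (near_cinv cx filterT).
  apply: filterS3 nG nE nc => p dG pE [cp _ cpp].
  apply/rowP => j; rewrite vA// mxE; case: (unliftP ord0 j) => [k|] jE.
    by rewrite pE.
  have := wE _ (endo_app phi X (cinv c p)) cp; rewrite cpp => E.
  by apply: (etrans E); exact: (metric_phi_xi hf hind).
Qed.

Lemma vf_rep_chart_at X x : vf_rep (chart_at x) X (chart_at x x) = X x.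
Proof.
by rewrite /vf_rep cfunK ?tcoord_chart_at//; exact: cdom_chart_at.
Qed.

Lemma diff_bracket_vf d x X Y : compatible_chart d -> cdom d (f x) ->
  smooth_vf X -> smooth_vf Y -> let a := chart_at x in let G := d \o f \o cinv a in
  'd G (a x) (bracket X Y x)
  = 'D_(X x) (fun p => 'd G p (vf_rep a Y p)) (a x)
    - 'D_(Y x) (fun p => 'd G p (vf_rep a X p)) (a x).
Proof.
move=> cd dfx sX sY a G.
have aa : atlas a by exact: chart_at_atlas.
have ax : cdom a x by exact: cdom_chart_at.
have := diff_bracket (smooth_map_at hf.1 aa ax cd dfx)
  (smooth_vf_at sX aa ax) (smooth_vf_at sY aa ax).
by rewrite !vf_rep_chart_at.
Qed.

Lemma derive_diff_phi d x X w : holomorphic_chart d -> cdom d (f x) ->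
  smooth_vf X -> let a := chart_at x in let G := d \o f \o cinv a in
  'D_w (fun p => 'd G p (vf_rep a (endo_app phi X) p)) (a x)
  = std_complex ('D_w (fun p => 'd G p (vf_rep a X p)) (a x)).
Proof.
move=> hd dfx sX a G.
have aa : atlas a by exact: chart_at_atlas.
have ax : cdom a x by exact: cdom_chart_at.
apply: (etrans (near_eq_deriv w (near_diff_vf_phi X aa ax hd dfx))).
apply: derive_std_complex; apply: smooth_at_diff_along.
  exact: (smooth_map_at hf.1 aa ax hd.1 dfx).
exact: smooth_vf_at.
Qed.

Lemma diff_phi d x v : holomorphic_chart d -> cdom d (f x) ->
  let a := chart_at x in let G := d \o f \o cinv a in
  'd G (a x) (phi x v) = std_complex ('d G (a x) v).
Proof.
move=> hd dfx a G.
have aa : atlas a by exact: chart_at_atlas.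
have ax : cdom a x by exact: cdom_chart_at.
have := diff_dmap hf.1 (phi x v) aa ax hd.1 dfx.
have := diff_dmap hf.1 v aa ax hd.1 dfx.
rewrite !tcoord_chart_at -/G; move: ('d G _ v) => w -> E; apply: (etrans E).
by rewrite (dmap_phi hf hind) hd.2.
Qed.

Lemma vertical_diff d x v : compatible_chart d -> cdom d (f x) ->
  'd (d \o f \o cinv (chart_at x)) (chart_at x x) v = 0 -> vertical f x v.
Proof.
move=> cd dfx; rewrite -{1}(tcoord_chart_at x v).
apply: diff_vf_rep => //; [exact: chart_at_atlas | exact: cdom_chart_at].
Qed.

(** Here [T] is the differential of [f] in charts and [P] is [phi]. The images under [T] of [Y] and
    [X] are differentiated along [X] and [Y] in [a1] and [a2], and along [phi X] and [phi Y] in [a3]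
    and [a4]. *)
Lemma related_nijenhuis_eq0 (T : {linear 'rV[R]_((n + n).+1) -> 'rV[R]_(n + n)})
    (P : 'rV[R]_((n + n).+1) -> 'rV[R]_((n + n).+1)) v1 v2 v3 v4 a1 a2 a3 a4 :
  (forall v, T (P v) = std_complex (T v)) -> T v1 = a1 - a2 ->
  T v2 = std_complex a3 - std_complex a4 -> T v3 = a3 - std_complex a2 ->
  T v4 = std_complex a1 - a4 -> T (P (P v1) + v2 - P v3 - P v4) = 0.
Proof.
move=> TP T1 T2 T3 T4; rewrite linearB linearB linearD !TP T1 T2 T3 T4.
rewrite !std_complexB !std_complexK; apply/rowP => j; rewrite !mxE; ring.
Qed.

Lemma related_lie_eq0 (T : {linear 'rV[R]_((n + n).+1) -> 'rV[R]_(n + n)}) v1 v2 v3 a :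
  T v1 = a -> T v2 = std_complex a -> T v3 = std_complex (T v1) -> T (v2 - v3) = 0.
Proof. by move=> T1 T2 T3; rewrite linearB T3 T2 T1 subrr. Qed.

Lemma vertical_nijenhuis x X Y : smooth_vf X -> smooth_vf Y ->
  vertical f x (nijenhuis phi X Y x).
Proof.
move=> sX sY; have [d hd dfx] := holomorphic_chart_at x.
apply: (vertical_diff hd.1 dfx).
have sfX := smooth_phi sX; have sfY := smooth_phi sY.
have B1 := diff_bracket_vf hd.1 dfx sX sY.
have B2 := diff_bracket_vf hd.1 dfx sfX sfY.
have B3 := diff_bracket_vf hd.1 dfx sfX sY.
have B4 := diff_bracket_vf hd.1 dfx sX sfY.
have DX w := derive_diff_phi w hd dfx sX.
have DY w := derive_diff_phi w hd dfx sY.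
have P v := diff_phi v hd dfx.
pose sub u v : 'rV[R]_(n + n) := u - v.
have {}B2 := etrans B2 (congr2 sub (DY _) (DX _)).
have {}B3 := etrans B3 (congr2 sub erefl (DX _)).
have {}B4 := etrans B4 (congr2 sub (DY _) erefl).
exact: related_nijenhuis_eq0 P B1 B2 B3 B4.
Qed.

(** The image of [xi] is zero near the point, so only the derivative along [xi] of the image of [Y]
    survives in the two brackets. *)
Lemma vertical_lie_phi x Y : smooth_vf Y ->
  vertical f x (bracket xi (endo_app phi Y) x - phi x (bracket xi Y x)).
Proof.
move=> sY; have [d hd dfx] := holomorphic_chart_at x.
apply: (vertical_diff hd.1 dfx).
have sfY := smooth_phi sY; have sxi := ind_xi_smooth hind.
have aa := chart_at_atlas x; have ax := cdom_chart_at x.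
have X0 w := etrans (near_eq_deriv w (near_diff_vf_xi aa ax hd.1 dfx))
  (derive_cst _ _ _).
have DY w := derive_diff_phi w hd dfx sY.
pose sub u v : 'rV[R]_(n + n) := u - v.
have B1 := etrans (diff_bracket_vf hd.1 dfx sxi sY) (congr2 sub erefl (X0 _)).
have B2 := etrans (diff_bracket_vf hd.1 dfx sxi sfY) (congr2 sub (DY _) (X0 _)).
have P v := diff_phi v hd dfx.
move: B1 B2 (P (bracket xi Y x)); rewrite /sub !subr0.
exact: related_lie_eq0.
Qed.

End InducedCalculus.

(** * Normality *)

Section Normality.
Context {R : realType} {n : nat} {M : manifold R (n + n).+1} {N : manifold R (n + n)}.
Context {g : riem_metric M} {J : endo N} {h : riem_metric N} {f : M -> N}.
Context {nabla : vfield M -> vfield M -> vfield M}.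
Context {phi : endo M} {xi : vfield M} {eta : M -> 'rV[R]_((n + n).+1) -> R}.
Context (hJ : hermitian_structure J h) (hf : submersion f) (hphwc : PHWC f g J h)
  (hnabla : levi_civita g nabla) (hind : induced_structure f g J phi xi eta).
Implicit Types (x : M) (X Y Z : vfield M).

Let sxi : smooth_vf xi := ind_xi_smooth hind.
Let sphi X : smooth_vf X -> smooth_vf (endo_app phi X) := smooth_phi hJ hf hind (X := X).

(** * The connection, [xi] and the exterior derivative of [eta] *)

Lemma vderiv_cst X (a : R) x : vderiv X (fun=> a) x = 0.
Proof. exact: derive_cst. Qed.

Lemma nabla_metric_cst X Y Z (a : R) x : smooth_vf X -> smooth_vf Y -> smooth_vf Z ->
  (forall y, g y (Y y) (Z y) = a) ->
  g x (nabla X Y x) (Z x) = - g x (Y x) (nabla X Z x).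
Proof.
move=> sX sY sZ YZ; have := lc_metric hnabla sX sY sZ x.
rewrite (funext YZ) vderiv_cst => /eqP; rewrite eq_sym addr_eq0 => /eqP->.
by [].
Qed.

Lemma nabla_xi_orthogonal X x : smooth_vf X -> g x (nabla X xi x) (xi x) = 0.
Proof.
move=> sX; have := nabla_metric_cst x sX sxi sxi (ind_xi_unit hind).
by rewrite [in RHS]Defs.metric_sym; lra.
Qed.

Lemma nabla_zero X x : smooth_vf X -> nabla (fun=> 0) X x = 0.
Proof.
(* Writing the zero field as [1 *: 0 + 0] makes the derivative equal to twice itself. *)
move=> sX; have := lc_linear hnabla (smooth_fun_cst 1) smooth_vf0 smooth_vf0 sX x.
have -> : (fun _ : M => 1 *: 0 + 0 : 'rV[R]_((n + n).+1)) = fun=> 0.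
  by apply/funext => y; rewrite scaler0 addr0.
by rewrite scale1r => /eqP; rewrite -subr_eq0 opprD addNKr oppr_eq0 => /eqP.
Qed.

Lemma nabla_opp X Y x : smooth_vf X -> smooth_vf Y ->
  nabla X (fun y => - Y y) x = - nabla X Y x.
Proof.
move=> sX sY; have := lc_leibniz hnabla (smooth_fun_cst (-1)) sX sY x.
rewrite vderiv_cst scale0r add0r scaleN1r => <-.
by congr (nabla X _ x); apply/funext => y; rewrite scaleN1r.
Qed.

Lemma torsion_free X Y x : smooth_vf X -> smooth_vf Y ->
  nabla X Y x = bracket X Y x + nabla Y X x.
Proof. by move=> sX sY; rewrite -(lc_torsion_free hnabla sX sY) subrK. Qed.

Lemma smooth_opp X : smooth_vf X -> smooth_vf (fun x => - X x).
Proof.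
move=> sX; have -> : (fun x => - X x) = (fun x => 0 - X x).
  by apply/funext => x; rewrite sub0r.
exact: smooth_vfB smooth_vf0 sX.
Qed.

(** Metric compatibility expands the two derivatives, and torsion-freeness cancels the terms in
    which [xi] is not differentiated. *)
Lemma dform_nabla X Y x : smooth_vf X -> smooth_vf Y ->
  2 * dform eta X Y x = g x (nabla X xi x) (Y x) - g x (nabla Y xi x) (X x).
Proof.
move=> sX sY; rewrite /dform mulrA divff ?pnatr_eq0// mul1r.
have etaE Z : (fun y => eta y (Z y)) = (fun y => g y (Z y) (xi y)).
  by apply/funext => y; rewrite (ind_eta hind).
rewrite !etaE (ind_eta hind).
have := lc_metric hnabla sX sY sxi x; have := lc_metric hnabla sY sX sxi x.
move: (vderiv _ _ _) (vderiv _ _ _) => a b -> ->.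
rewrite (torsion_free x sX sY) metricDl.
rewrite (Defs.metric_sym g x (Y x)) (Defs.metric_sym g x (X x)); ring.
Qed.

Lemma dform_phi X Y x :
  2 * dform eta (endo_app phi X) (endo_app phi Y) x
  = - g x (bracket (endo_app phi X) (endo_app phi Y) x) (xi x).
Proof.
rewrite /dform mulrA divff ?pnatr_eq0// mul1r.
have eta0 Z : (fun y => eta y (endo_app phi Z y)) = fun=> 0.
  by apply/funext => y; rewrite (ind_eta hind) (metric_phi_xi hf hind).
by rewrite !eta0 !vderiv_cst (ind_eta hind) subrr sub0r.
Qed.

(** The tensor is vertical, hence determined by its inner product with [xi], to which terms in the
    image of [phi] contribute nothing. *)
Lemma nijenhuisE X Y x : smooth_vf X -> smooth_vf Y ->
  nijenhuis phi X Y x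
  = - (2 * dform eta (endo_app phi X) (endo_app phi Y) x) *: xi x.
Proof.
move=> sX sY; rewrite [LHS](verticalE hf hind (vertical_nijenhuis hJ hf hind x sX sY)).
congr (_ *: _); rewrite dform_phi opprK /nijenhuis.
move: (bracket X Y x) (bracket (endo_app phi X) (endo_app phi Y) x).
move: (bracket (endo_app phi X) Y x) (bracket X (endo_app phi Y) x) => b1 b2 b3 b4.
by rewrite !metricBl metricDl !(metric_phi_xi hf hind) add0r !subr0.
Qed.

(** By [nijenhuisE] the normality tensor is twice the difference of the two values of [dform eta],
    times the nowhere zero field [xi]. *)
Lemma normal_dform :
  normal_structure phi xi eta <-> forall X Y, smooth_vf X -> smooth_vf Y -> forall x,
    dform eta (endo_app phi X) (endo_app phi Y) x = dform eta X Y x.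
Proof.
split=> H X Y sX sY x; last first.
  by rewrite nijenhuisE// H// -scalerDl addNr scale0r.
have := H X Y sX sY x; rewrite (nijenhuisE x sX sY).
move: (dform _ _ _ _) (dform _ _ _ _) (xi_neq0 hind x) => p q x0.
rewrite -scalerDl => /eqP; rewrite scaler_eq0 (negbTE x0) orbF => /eqP; lra.
Qed.

(** * Minimality of the fibers *)

Lemma horizontal_partE x u v : horizontal f g x u -> vertical f x (v - u) ->
  horizontal_part f g x v = u.
Proof.
move=> hu vu; rewrite /horizontal_part.
have : exists w, [set w | horizontal f g x w /\ vertical f x (v - w)] w by exists u.
move=> /getPex; set w := get _ => -[hw vw]; apply/eqP; rewrite -subr_eq0; apply/eqP.
apply: (horizontal_vertical_eq0 hf hind (x := x)).
  by move=> t vt; rewrite metricBl hw// hu// subrr.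
have -> : w - u = (v - u) - (v - w) by rewrite [RHS]addrC opprB addrA subrK.
by rewrite /vertical dmapB vu vw subrr.
Qed.

(** The field [xi] alone is a vertical orthonormal basis, and its derivative along itself is already
    horizontal. Conversely a vertical field is [a *: xi], whose derivative along itself is vertical
    once [nabla xi xi] vanishes. *)
Lemma minimal_fibersP :
  minimal_fibers f g nabla <-> forall x, nabla xi xi x = 0.
Proof.
split=> [mf x|xi0 x k E sE vE _].
  have := mf x 1%N (fun=> xi) (fun=> sxi) (fun=> ind_xi_vertical hind).
  rewrite invr1 scale1r big_ord1 /second_fundamental_form.
  rewrite (@horizontal_partE _ (nabla xi xi x)); first apply.
  - split=> [_|i j|v vv]; first exact: ind_xi_vertical hind x.
      by rewrite !ord1 (ind_xi_unit hind).
    by rewrite big_ord1 {1}(verticalE hf hind vv).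
  - exact/(horizontalP hf hind)/nabla_xi_orthogonal.
  - by rewrite /vertical subrr; exact: linear0.
rewrite big1 ?scaler0// => i _; rewrite /second_fundamental_form.
apply: horizontal_partE; first by move=> w _; rewrite metric0l.
rewrite subr0; pose a y := g y (E i y) (xi y).
have sa : smooth_fun a by exact: smooth_fun_metric.
have Ea : E i = fun y => a y *: xi y.
  by apply/funext => y; exact: (verticalE hf hind (vE i y)).
(* The zero summand gives the shape expected by [lc_linear]. *)
have Ea0 : E i = fun y => a y *: xi y + 0.
  by rewrite {1}Ea; apply/funext => y; rewrite addr0.
have Exi : nabla (E i) xi x = 0.
  rewrite Ea0 (lc_linear hnabla sa sxi smooth_vf0 sxi) xi0 scaler0 add0r.
  exact: nabla_zero.
rewrite {2}Ea (lc_leibniz hnabla sa (sE i) sxi) Exi scaler0 addr0.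
by rewrite /vertical dmapZ (dmap_xi hind) scaler0.
Qed.

Lemma nabla_endo_metric Y Z x : smooth_vf Y -> smooth_vf Z ->
  g x (nabla_endo nabla xi phi Y x) (Z x)
  = g x (nabla (endo_app phi Y) xi x) (Z x) + g x (nabla Y xi x) (endo_app phi Z x)
    - g x (Z x) (xi x) * g x (nabla xi xi x) (endo_app phi Y x).
Proof.
move=> sY sZ; have sfY := sphi sY.
rewrite /nabla_endo (torsion_free x sxi sfY) (torsion_free x sxi sY).
(* The Lie derivative of [phi] along [xi], applied to [Y]; it is a multiple of [xi]. *)
pose W := bracket xi (endo_app phi Y) x - phi x (bracket xi Y x).
have WE : W = g x W (xi x) *: xi x.
  exact: (verticalE hf hind (vertical_lie_phi hJ hf hind x sY)).
have -> : bracket xi (endo_app phi Y) x + nabla (endo_app phi Y) xi x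
    - phi x (bracket xi Y x + nabla Y xi x)
    = W + (nabla (endo_app phi Y) xi x - phi x (nabla Y xi x)).
  by rewrite [phi x _]linearD opprD addrACA.
rewrite metricDl metricBl (phi_skew hJ hf hphwc hind) opprK addrC; congr (_ + _).
rewrite WE metricZl (Defs.metric_sym g x (xi x)) mulrC -mulrN; congr (_ * _).
rewrite metricBl (metric_phi_xi hf hind) subr0.
(* For the [xi] component of [W], the bracket is turned back into covariant derivatives; as [phi Y]
   is orthogonal to [xi], the derivative then moves onto [xi]. *)
rewrite -(lc_torsion_free hnabla sxi sfY x) metricBl nabla_xi_orthogonal// subr0.
rewrite (@nabla_metric_cst _ _ _ 0)// => [|y]; last exact: (metric_phi_xi hf hind).
by rewrite Defs.metric_sym.
Qed.

(** Obtained by differentiating the skewness of [phi] along [xi]. *)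
Lemma nabla_endo_skew Y Z x : smooth_vf Y -> smooth_vf Z ->
  g x (nabla_endo nabla xi phi Y x) (Z x)
  = - g x (nabla_endo nabla xi phi Z x) (Y x).
Proof.
move=> sY sZ; have sfY := sphi sY; have sfZ := sphi sZ.
have skew := phi_skew hJ hf hphwc hind.
have := lc_metric hnabla sxi sY (smooth_opp sfZ) x.
have -> : (fun y => g y (Y y) (- endo_app phi Z y))
    = (fun y => g y (endo_app phi Y y) (Z y)).
  by apply/funext => y; rewrite metricNr -skew.
rewrite (lc_metric hnabla sxi sfY sZ) (nabla_opp x sxi sfZ) !metricNr => E.
rewrite /nabla_endo !metricBl (skew x (nabla xi Y x)) (skew x (nabla xi Z x)).
rewrite (Defs.metric_sym g x (nabla xi (endo_app phi Z) x) (Y x)).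
rewrite (Defs.metric_sym g x (nabla xi Z x)).
rewrite -/(endo_app phi Y x) -/(endo_app phi Z x).
move: E; move: (g x _ _) (g x _ _) (g x _ _) (g x _ _) => a b c d; lra.
Qed.

Lemma smooth_nabla_endo Y : smooth_vf Y -> smooth_vf (nabla_endo nabla xi phi Y).
Proof.
move=> sY; apply: smooth_vfB; first exact: lc_smooth hnabla _ _ sxi (sphi sY).
exact/sphi/(lc_smooth hnabla).
Qed.

(** The sum of [Y] and [phi (phi Y)] is a multiple of [xi], along which [xi] has zero derivative. *)
Lemma nabla_phi_phi Y x : smooth_vf Y -> (forall y, nabla xi xi y = 0) ->
  nabla (endo_app phi (endo_app phi Y)) xi x = - nabla Y xi x.
Proof.
move=> sY xi0; have sffY := sphi (sphi sY).
have sa : smooth_fun (fun y => g y (Y y) (xi y)) by exact: smooth_fun_metric.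
have := lc_linear hnabla (smooth_fun_cst 1) sffY sY sxi x.
have -> : (fun y => 1 *: endo_app phi (endo_app phi Y) y + Y y)
    = (fun y => g y (Y y) (xi y) *: xi y + 0).
  apply/funext => y; rewrite scale1r /endo_app (phi_phi hJ hf hind).
  by rewrite addrAC addNr add0r addr0.
rewrite (lc_linear hnabla sa sxi smooth_vf0 sxi) xi0 scaler0 add0r nabla_zero//.
by rewrite scale1r => /esym/eqP; rewrite addr_eq0 => /eqP.
Qed.

(** With [K = nabla xi xi], the invariance of [dform eta] is tested on [xi] and [K]: one side
    vanishes since [phi xi = 0], the other is the squared length of [K]. *)
Lemma normal_nabla_xi_xi : normal_structure phi xi eta -> forall x, nabla xi xi x = 0.
Proof.
move=> /normal_dform nd x; have sK := lc_smooth hnabla sxi sxi.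
have phixi : endo_app phi xi = fun=> 0.
  by apply/funext => y; exact: ind_phi_xi hind y.
have := etrans (esym (dform_nabla x (sphi sxi) (sphi sK)))
  (etrans (congr1 ( *%R 2) (nd _ _ sxi sK x)) (dform_nabla x sxi sK)).
rewrite phixi (nabla_zero x sxi) metric0l metric0r subrr.
by rewrite (nabla_xi_orthogonal x sK) subr0 => /esym/metric_eq0.
Qed.

(** The derivative [Z] of [phi] on [Y] is paired with itself. Writing [B (X, Y)] for
    [g (nabla_X xi, Y)], the squared length is [B (phi Y, Z) + B (Y, phi Z)] by [ez], and minus the
    same sum with [Y] and [Z] exchanged by [es]. *)
Lemma normal_nabla_phi : normal_structure phi xi eta ->
  forall Y, smooth_vf Y -> forall x, nabla_endo nabla xi phi Y x = 0.
Proof.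
move=> nrm Y sY x; have xi0 := normal_nabla_xi_xi nrm.
move: nrm => /normal_dform nd; have sZ := smooth_nabla_endo sY.
apply: (@metric_eq0 _ _ _ g); set Z := nabla_endo nabla xi phi Y in sZ *.
have ez := nabla_endo_metric x sY sZ; have es := nabla_endo_skew x sY sZ.
rewrite (nabla_endo_metric x sZ sY) in es.
rewrite !xi0 !metric0l !mulr0 !subr0 -/Z in ez es.
have sfY := sphi sY; have sfZ := sphi sZ; have sffZ := sphi sfZ.
(* Invariance on the pair [Y], [phi Z] equates the two sums, so the squared length equals its own
   opposite. *)
have := etrans (esym (dform_nabla x sfY sffZ))
  (etrans (congr1 ( *%R 2) (nd _ _ sY sfZ x)) (dform_nabla x sY sfZ)).
rewrite (nabla_phi_phi x sZ xi0).
have -> : endo_app phi (endo_app phi Z) x = - Z x + g x (Z x) (xi x) *: xi x.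
  exact: (phi_phi hJ hf hind).
rewrite metricDr metricNr metricZr (nabla_xi_orthogonal x sfY) mulr0 addr0 metricNl.
lra.
Qed.

(** With [K = nabla xi xi], [nabla_endo_metric] is tested on [phi K] and [xi]: only its last term
    remains, and it is the squared length of [K] because [phi (phi K) = - K]. *)
Lemma parallel_nabla_xi_xi :
  (forall Y, smooth_vf Y -> forall x, nabla_endo nabla xi phi Y x = 0) ->
  forall x, nabla xi xi x = 0.
Proof.
move=> par x; have sK := lc_smooth hnabla sxi sxi.
have e1 := nabla_xi_orthogonal x (sphi (sphi sK)).
have e2 : endo_app phi xi x = 0 by exact: ind_phi_xi hind x.
have e3 : endo_app phi (endo_app phi (nabla xi xi)) x = - nabla xi xi x.
  apply: (etrans (phi_phi hJ hf hind x (nabla xi xi x))).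
  by rewrite (nabla_xi_orthogonal x sxi) scale0r addr0.
have := nabla_endo_metric x (sphi sK) sxi.
rewrite (par _ (sphi sK)) e1 e2 e3 (ind_xi_unit hind) metric0l metric0r metricNr.
by rewrite mul1r opprK !add0r => /esym/metric_eq0.
Qed.

(** Replacing [Y] by [phi Y] in [nabla_endo_metric] shows that the form [g (nabla_X xi, Y)] is
    itself invariant under [phi]; its antisymmetrization, [2 * dform eta], is then invariant too. *)
Lemma parallel_normal :
  (forall Y, smooth_vf Y -> forall x, nabla_endo nabla xi phi Y x = 0) ->
  normal_structure phi xi eta.
Proof.
move=> par; have xi0 := parallel_nabla_xi_xi par.
have BE X Y x (sX : smooth_vf X) (sY : smooth_vf Y) :
    g x (nabla (endo_app phi X) xi x) (endo_app phi Y x) = g x (nabla X xi x) (Y x).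
  have sfX := sphi sX; have := nabla_endo_metric x sX (sphi sY).
  rewrite (par _ sX) metric0l xi0 metric0l mulr0 subr0.
  have -> : endo_app phi (endo_app phi Y) x = - Y x + g x (Y x) (xi x) *: xi x.
    exact: (phi_phi hJ hf hind).
  rewrite metricDr metricNr metricZr (nabla_xi_orthogonal x sX) mulr0 addr0; lra.
apply/normal_dform => X Y sX sY x; have sfX := sphi sX; have sfY := sphi sY.
apply: (@mulfI _ 2); first by rewrite pnatr_eq0.
have E := congr2 (fun a b : R => a - b) (BE X Y x sX sY) (BE Y X x sY sX).
exact: etrans (dform_nabla x sfX sfY) (etrans E (esym (dform_nabla x sX sY))).
Qed.

End Normality.

Theorem theorem4p1 (R : realType) (n : nat)
    (M : manifold R (n + n).+1) (N : manifold R (n + n))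
    (O : set (chart R (n + n).+1 M)) (g : riem_metric M)
    (J : endo N) (h : riem_metric N) (f : M -> N)
    (nabla : vfield M -> vfield M -> vfield M)
    (phi : endo M) (xi : vfield M) (eta : M -> 'rV[R]_((n + n).+1) -> R)
    (hO : orientation O)
    (hJ : hermitian_structure J h)
    (hf : submersion f)
    (hsurj : forall y : N, exists x : M, f x = y)
    (hphwc : PHWC f g J h)
    (hnabla : levi_civita g nabla)
    (hind : induced_structure f g J phi xi eta) :
  let cond_i :=
    minimal_fibers f g nabla /\
    (forall X Y : vfield M, smooth_vf X -> smooth_vf Y -> forall x : M,
       dform eta (endo_app phi X) (endo_app phi Y) x = dform eta X Y x) in
  let cond_ii :=
    forall Y : vfield M, smooth_vf Y -> forall x : M,
      nabla_endo nabla xi phi Y x = 0 in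
  [/\ normal_structure phi xi eta <-> cond_i,
      normal_structure phi xi eta <-> cond_ii
    & cond_ii -> minimal_fibers f g nabla].
Proof.
move=> cond_i cond_ii; split.
- split=> [nrm|[_ /(normal_dform hJ hf hind)]//].
  split; last exact/(normal_dform hJ hf hind).
  exact/(minimal_fibersP hf hnabla hind)/(normal_nabla_xi_xi hJ hf hnabla hind).
- split; first exact: (normal_nabla_phi hJ hf hphwc hnabla hind).
  exact: (parallel_normal hJ hf hphwc hnabla hind).
- move=> par; apply/(minimal_fibersP hf hnabla hind).
  exact: (parallel_nabla_xi_xi hJ hf hphwc hnabla hind par).
Qed.
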